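(* Let $(\Sigma,\mathbb M)$ be a surface with marked points and non-empty boundary, $\tau$ a valency $\geq3$-triangulation of $(\Sigma,\mathbb M)$, $d$ an admissible cut for $\tau$, $\Lambda=\Lambda(\tau,d)$ the degree-zero subalgebra of the graded Jacobian algebra $\mathcal P(Q(\tau),S(\tau),d)$, and $i$ an arc of $\tau$. The simple $\Lambda$-module $S(i)$ associated with $i$ has projective dimension $\geq3$ if and only if $i$ lies in one of the following two configurations: (I) There is an internal triangle $\triangle$ of $\tau$ with sides $i,j,k$, occurring in this clockwise order along the boundary of $\triangle$, such that: the vertex $B$ of $\triangle$ between $j$ and $k$ is a puncture; the arrow $k\to i$ lying in $\triangle$ has degree $1$; and the other triangle of $\tau$ having $j$ as a side has sides $j$, an arc $m$ and a boundary segment, where $j$ and $m$ meet (in this triangle) at the puncture $B$, i.e. at the endpoint of $j$ shared with $k$ in $\triangle$, and the unique arrow of $Q(\tau)$ lying in this triangle (the arrow $m\to j$ at $B$) has degree $1$. (II) There is a triangle $\triangle$ of $\tau$ whose sides are $i$, an arc $k$ and a boundary segment, such that: the vertex of $\triangle$ between $i$ and $k$ is a puncture; the unique arrow of $Q(\tau)$ lying in $\triangle$ goes from $k$ to $i$ and has degree $1$; and the other triangle of $\tau$ having $k$ as a side is internal and its arrow sitting at the vertex opposite to $k$ has degree $1$.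
   Context: A surface with marked points $(\Sigma,\mathbb M)$ is a compact connected oriented surface $\Sigma$ with a finite non-empty set $\mathbb M\subset\Sigma$ containing at least one point on each boundary component; points of $\mathbb M$ in the interior are called punctures. The closed sphere with at most three punctures, the once-punctured monogon and the unpunctured disc with at most three marked points are excluded. Arcs and ideal triangulations are as in Fomin–Shapiro–Thurston. The valency of a puncture is the number of arc-ends incident to it; a valency $\geq3$-triangulation is an ideal triangulation in which every puncture has valency at least $3$ (so there are no self-folded triangles). A triangle is internal if all three of its sides are arcs. The quiver $Q(\tau)$ has the arcs of $\tau$ as vertices and, for each triangle and each pair of its sides $i,j$ that are arcs with $j$ immediately following $i$ clockwise along the boundary of the triangle, one arrow $i\to j$, sitting at the angle of the triangle between $i$ and $j$ (equivalently, arrows turn counterclockwise around marked points). With fixed non-zero scalars $x_p\in\mathbb C$, the potential is $S(\tau)=\sum_\triangle S^\triangle+\sum_px_pS^p$, where $S^\triangle$ is the 3-cycle of arrows in the internal triangle $\triangle$ and $S^p$ is the cycle formed by all arrows at the puncture $p$. The Jacobian algebra is the quotient of the complete path algebra $\mathbb C\langle\langle Q(\tau)\rangle\rangle$ by the closure of the ideal generated by the cyclic derivatives $\partial_aS(\tau)$. An admissible cut for $\tau$ is a map $d:Q(\tau)_1\to\{0,1\}$ such that every cycle appearing in $S(\tau)$ has total degree $1$ and $d(a)=0$ for every arrow $a$ not appearing in $S(\tau)$; it induces a grading on the Jacobian algebra. The Gabriel quiver $Q(\Lambda)$ of the degree-zero subalgebra $\Lambda$ is obtained from $Q(\tau)$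 by deleting the arrows of degree 1, and the ideal of relations is generated by the $\partial_aS(\tau)$ with $d(a)=1$. Modules over $\Lambda$ are identified with representations of $Q(\Lambda)$ satisfying the relations, so that the indecomposable projective $P(i)$ with top $S(i)$ has a basis given by (classes of) paths starting at $i$. In configurations (I) and (II) marked points that are not explicitly said to be punctures may or may not be punctures, and identifications between vertices or sides are allowed. *)

(* Defs.v *)
From HB Require Import structures.
From mathcomp Require Import all_boot all_order all_algebra.
From mathcomp Require Import generic_quotient ring_quotient.
From mathcomp Require Import boolp reals complex.

Set Implicit Arguments.
Unset Strict Implicit.
Unset Printing Implicit Defensive.

Import GRing.Theory.

Local Open Scope ring_scope.
Local Open Scope quotient_scope.

Section ProjectiveDimension.
Variable A : pzRingType.

Definition projective (P : lmodType A) : Prop :=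
  forall (M N : lmodType A) (g : {linear M -> N}) (f : {linear P -> N}),
    (forall y, exists x, g x = y) ->
    exists h : {linear P -> M}, forall x, g (h x) = f x.

(* There is an exact sequence  0 -> P_n -> ... -> P_1 -> P_0 -> M -> 0  with
   all P_k projective; it is padded with zero modules in degrees > n. *)
Definition projective_resolution_of_length (M : lmodType A) (n : nat) : Prop :=
  exists (P : nat -> lmodType A) (d : forall k, {linear P k.+1 -> P k})
         (e : {linear P 0%N -> M}),
    [/\ forall k, projective (P k),
        forall k, (n < k)%N -> forall x : P k, x = 0,
        forall y, exists x, e x = y,
        forall x, e x = 0 <-> exists y, d 0%N y = x
      & forall k x, d k x = 0 <-> exists y, d k.+1 y = x].

(* This holds for every n when M has no finite projective resolution. *)
Definition pdim_ge (M : lmodType A) (n : nat) : Prop :=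
  forall m, projective_resolution_of_length M m -> (n <= m)%N.

End ProjectiveDimension.

Record quiver := Quiver {
  vertex : finType;
  arrow : finType;
  source : arrow -> vertex;
  target : arrow -> vertex }.

Section Paths.
Variable Q : quiver.

Fixpoint walk (v : vertex Q) (w : seq (arrow Q)) : bool :=
  if w is a :: w' then (source a == v) && walk (target a) w' else true.

Definition endpoint (v : vertex Q) (w : seq (arrow Q)) : vertex Q :=
  last v (map (@target Q) w).

(* A path is a starting vertex with the list of its arrows, in the order in
   which they are travelled; (v, [::]) is the trivial path at v. *)
Definition qpath := {p : vertex Q * seq (arrow Q) | walk p.1 p.2}.

Definition pstart (p : qpath) : vertex Q := (val p).1.
Definition parrows (p : qpath) : seq (arrow Q) := (val p).2.
Definition pend (p : qpath) : vertex Q := endpoint (pstart p) (parrows p).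
Definition plen (p : qpath) : nat := size (parrows p).

Definition ptriv (v : vertex Q) : qpath := exist _ (v, [::]) isT.

Lemma walk_cat v w1 w2 :
  walk v (w1 ++ w2) = walk v w1 && walk (endpoint v w1) w2.
Proof. by elim: w1 v => //= a w IH v; rewrite IH andbA. Qed.

Lemma endpoint_cat v w1 w2 :
  endpoint v (w1 ++ w2) = endpoint (endpoint v w1) w2.
Proof. by rewrite /endpoint map_cat last_cat. Qed.

Lemma ptake_subproof k (p : qpath) : walk (pstart p) (take k (parrows p)).
Proof.
by have := valP p; rewrite /= -{1}(cat_take_drop k (val p).2) walk_cat => /andP[].
Qed.

Lemma pdrop_subproof k (p : qpath) :
  walk (endpoint (pstart p) (take k (parrows p))) (drop k (parrows p)).
Proof.
by have := valP p; rewrite /= -{1}(cat_take_drop k (val p).2) walk_cat => /andP[].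
Qed.

Definition ptake k (p : qpath) : qpath :=
  exist _ (pstart p, take k (parrows p)) (ptake_subproof k p).
Definition pdrop k (p : qpath) : qpath :=
  exist _ (endpoint (pstart p) (take k (parrows p)), drop k (parrows p))
    (pdrop_subproof k p).

Lemma qpath_eq (p q : qpath) :
  pstart p = pstart q -> parrows p = parrows q -> p = q.
Proof.
rewrite /pstart /parrows => e1 e2; apply: val_inj => /=.
by rewrite (surjective_pairing (sval p)) (surjective_pairing (sval q)) e1 e2.
Qed.

Lemma ptake_ptake k m (p : qpath) : (k <= m)%N -> ptake k (ptake m p) = ptake k p.
Proof. by move=> km; apply: qpath_eq => //; rewrite /parrows /= take_takel. Qed.

Lemma pdrop_pdrop l k (p : qpath) : pdrop l (pdrop k p) = pdrop (l + k) p.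
Proof.
apply: qpath_eq; rewrite /parrows /pstart /= ?drop_drop //.
by rewrite -endpoint_cat addnC takeD.
Qed.

Lemma ptake_pdrop l k (p : qpath) : ptake l (pdrop k p) = pdrop k (ptake (l + k) p).
Proof.
apply: qpath_eq; rewrite /parrows /pstart /=.
  by rewrite take_takel // leq_addl.
by rewrite take_drop.
Qed.

Lemma plen_ptake k p : (k <= plen p)%N -> plen (ptake k p) = k.
Proof. by move=> kp; rewrite /plen /parrows /= size_takel. Qed.

Lemma plen_pdrop k p : plen (pdrop k p) = (plen p - k)%N.
Proof. by rewrite /plen /parrows /= size_drop. Qed.

Lemma ptake_full p : ptake (plen p) p = p.
Proof. by apply: qpath_eq; rewrite /parrows //= take_oversize. Qed.

Lemma pdrop0 p : pdrop 0 p = p.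
Proof. by apply: qpath_eq; rewrite /parrows /pstart /= ?take0 ?drop0. Qed.

End Paths.

(* A possibly infinite linear combination of paths, given by its
   coefficients. *)
Definition cpa (K : fieldType) (Q : quiver) := qpath Q -> K.

Section CompletePathAlgebra.
Variables (K : fieldType) (Q : quiver).
Implicit Types f g h : cpa K Q.

Definition cpa_zero : cpa K Q := fun=> 0.
Definition cpa_opp f : cpa K Q := fun p => - f p.
Definition cpa_add f g : cpa K Q := fun p => f p + g p.
Definition cpa_one : cpa K Q := fun p => (plen p == 0%N)%:R.
(* Paths are composed like functions: f * g is "first g, then f". With this
   convention left modules are representations of Q, and A * e_i is spanned by
   the paths starting at i. *)
Definition cpa_mul f g : cpa K Q :=
  fun p => \sum_(k < (plen p).+1) f (pdrop k p) * g (ptake k p).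

HB.instance Definition _ := gen_eqMixin (cpa K Q).
HB.instance Definition _ := gen_choiceMixin (cpa K Q).

Lemma cpa_addA : associative cpa_add.
Proof. by move=> f g h; apply: funext => p; rewrite /cpa_add addrA. Qed.
Lemma cpa_addC : commutative cpa_add.
Proof. by move=> f g; apply: funext => p; rewrite /cpa_add addrC. Qed.
Lemma cpa_add0 : left_id cpa_zero cpa_add.
Proof. by move=> f; apply: funext => p; rewrite /cpa_add add0r. Qed.
Lemma cpa_addN : left_inverse cpa_zero cpa_opp cpa_add.
Proof. by move=> f; apply: funext => p; rewrite /cpa_add addNr. Qed.

HB.instance Definition _ :=
  GRing.isZmodule.Build (cpa K Q) cpa_addA cpa_addC cpa_add0 cpa_addN.

Lemma cpa_mulE f g p (n := plen p) :
  cpa_mul f g p = \sum_(0 <= k < n.+1) f (pdrop k p) * g (ptake k p).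
Proof. by rewrite big_mkord. Qed.

Lemma cpa_mulA : associative cpa_mul.
Proof.
move=> f g h; apply: funext => p; rewrite !cpa_mulE.
set n := plen p.
transitivity (\sum_(0 <= m < n.+1) \sum_(0 <= k < n.+1 | (k <= m)%N)
   f (pdrop m p) * g (pdrop k (ptake m p)) * h (ptake k p)).
  apply: eq_big_nat => m /andP[_]; rewrite ltnS => mn.
  rewrite cpa_mulE plen_ptake // mulr_sumr.
  rewrite (big_nat_widen _ _ n.+1) ?ltnS //.
  rewrite [in LHS]big_nat_cond [in RHS]big_nat_cond.
  apply: eq_big => [k|k]; first by rewrite ltnS.
  by rewrite ltnS => /andP[_ km]; rewrite mulrA ptake_ptake.
rewrite (exchange_big_dep_nat predT) //=.
apply: eq_big_nat => k /andP[_]; rewrite ltnS => kn.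
rewrite cpa_mulE plen_pdrop mulr_suml -/n.
rewrite (@big_cat_nat _ _ _ k) //=; last exact: leqW.
rewrite [X in X + _]big_nat_cond big1 ?add0r; last first.
  by move=> m /andP[/andP[_ mk] km]; move: mk; rewrite ltnNge km.
rewrite -{1}[k]add0n big_addn subSn //.
rewrite [in LHS]big_nat_cond [in RHS]big_nat_cond.
apply: eq_big => [l|l _]; first by rewrite leq_addl.
by rewrite pdrop_pdrop ptake_pdrop.
Qed.

Lemma cpa_mul1l : left_id cpa_one cpa_mul.
Proof.
move=> f; apply: funext => p; rewrite /cpa_mul big_ord_recr /= big1 => [|k _].
  by rewrite add0r /cpa_one plen_pdrop subnn eqxx mul1r ptake_full.
by rewrite /cpa_one plen_pdrop subn_eq0 leqNgt ltn_ord mul0r.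
Qed.

Lemma cpa_mul1r : right_id cpa_one cpa_mul.
Proof.
move=> f; apply: funext => p; rewrite /cpa_mul big_ord_recl /= big1 => [|k _].
  by rewrite addr0 /cpa_one plen_ptake // eqxx mulr1 pdrop0.
by rewrite /cpa_one plen_ptake ?mulr0 // /bump /= add1n.
Qed.

Lemma cpa_mulDl : left_distributive cpa_mul cpa_add.
Proof.
move=> f g h; apply: funext => p; rewrite /cpa_mul /cpa_add -big_split /=.
by apply: eq_bigr => k _; rewrite mulrDl.
Qed.

Lemma cpa_mulDr : right_distributive cpa_mul cpa_add.
Proof.
move=> f g h; apply: funext => p; rewrite /cpa_mul /cpa_add -big_split /=.
by apply: eq_bigr => k _; rewrite mulrDr.
Qed.

HB.instance Definition _ := GRing.Zmodule_isPzRing.Build (cpa K Q)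
  cpa_mulA cpa_mul1l cpa_mul1r cpa_mulDl cpa_mulDr.

End CompletePathAlgebra.

Section JacobianAlgebra.
Variables (K : fieldType) (Q : quiver).
Implicit Types (f g h S : cpa K Q) (p : qpath Q) (a : arrow Q).

Definition coef f (v : vertex Q) (w : seq (arrow Q)) : K :=
  if insub (v, w) is Some q then f q else 0.

(* The continuous linear map sending a cycle c to the sum, over the
   decompositions of c as a path u followed by a followed by a path v, of the
   path "v followed by u". The coefficient at a path p of the image of S is
   thus the sum over all ways to read p as v = ptake k p, u = pdrop k p. *)
Definition cyclic_derivative a S : cpa K Q := fun p =>
  if (pstart p == target a) && (pend p == source a) then
    \sum_(k < (plen p).+1)
      coef S (pstart (pdrop k p)) (parrows (pdrop k p) ++ a :: parrows (ptake k p))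
  else 0.

Definition derivative_ideal S f : Prop :=
  exists s : seq (cpa K Q * arrow Q * cpa K Q),
    f = \sum_(t <- s) t.1.1 * cyclic_derivative t.1.2 S * t.2.

(* The closure is taken in the topology whose neighbourhoods of 0 are the
   powers of the arrow ideal, the n-th of which consists of the series without
   terms of length < n. *)
Definition jacobian_ideal S f : Prop :=
  forall n : nat, exists2 g, derivative_ideal S g &
    forall p, (plen p < n)%N -> f p = g p.

Lemma derivative_idealB S f g :
  derivative_ideal S f -> derivative_ideal S g -> derivative_ideal S (f - g).
Proof.
move=> [s ->] [t ->]; exists (s ++ [seq (- u.1.1, u.1.2, u.2) | u <- t]).
rewrite big_cat big_map /= -sumrN; congr (_ + _).
by apply: eq_bigr => u _; rewrite !mulNr.
Qed.

Lemma derivative_idealMl S f g :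
  derivative_ideal S f -> derivative_ideal S (g * f).
Proof.
move=> [s ->]; exists [seq (g * u.1.1, u.1.2, u.2) | u <- s].
by rewrite big_map mulr_sumr; apply: eq_bigr => u _; rewrite !mulrA.
Qed.

Lemma derivative_idealMr S f g :
  derivative_ideal S f -> derivative_ideal S (f * g).
Proof.
move=> [s ->]; exists [seq (u.1.1, u.1.2, u.2 * g) | u <- s].
by rewrite big_map mulr_suml; apply: eq_bigr => u _; rewrite !mulrA.
Qed.

Lemma jacobian_ideal0 S : jacobian_ideal S 0.
Proof. by move=> n; exists 0 => //; exists [::]; rewrite big_nil. Qed.

Lemma jacobian_idealB S f g :
  jacobian_ideal S f -> jacobian_ideal S g -> jacobian_ideal S (f - g).
Proof.
move=> Jf Jg n; have [f' If' ff'] := Jf n; have [g' Ig' gg'] := Jg n.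
exists (f' - g'); first exact: derivative_idealB.
by move=> p pn; congr (_ - _); [apply: ff' | apply: gg'].
Qed.

Lemma jacobian_idealMl S f g : jacobian_ideal S f -> jacobian_ideal S (g * f).
Proof.
move=> Jf n; have [f' If' ff'] := Jf n.
exists (g * f'); first exact: derivative_idealMl.
move=> p pn; apply: eq_bigr => k _; congr (_ * _); apply: ff'.
have kp : (k <= plen p)%N by rewrite -ltnS.
by rewrite plen_ptake // (leq_ltn_trans kp pn).
Qed.

Lemma jacobian_idealMr S f g : jacobian_ideal S f -> jacobian_ideal S (f * g).
Proof.
move=> Jf n; have [f' If' ff'] := Jf n.
exists (f' * g); first exact: derivative_idealMr.
move=> p pn; apply: eq_bigr => k _; congr (_ * _); apply: ff'.
by rewrite plen_pdrop (leq_ltn_trans _ pn) // leq_subr.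
Qed.

Definition in_jacobian_ideal S : {pred cpa K Q} :=
  fun f => `[< jacobian_ideal S f >].

Lemma in_jacobian_idealP S f :
  reflect (jacobian_ideal S f) (f \in in_jacobian_ideal S).
Proof. exact: asboolP. Qed.

Lemma jacobian_ideal_zmod_closed S : zmod_closed (in_jacobian_ideal S).
Proof.
split; first by apply/in_jacobian_idealP; apply: jacobian_ideal0.
move=> f g /in_jacobian_idealP Jf /in_jacobian_idealP Jg.
by apply/in_jacobian_idealP; apply: jacobian_idealB.
Qed.

HB.instance Definition _ S := GRing.isZmodClosed.Build (cpa K Q)
  (in_jacobian_ideal S) (jacobian_ideal_zmod_closed S).

Definition jacobian S := Quotient.quot (in_jacobian_ideal S).

HB.instance Definition _ S := GRing.Zmodule.on (jacobian S).
HB.instance Definition _ S := Quotient.on (jacobian S).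

Definition jproj S (f : cpa K Q) : jacobian S := \pi_(jacobian S) f.

Lemma jprojP S f g : jproj S f = jproj S g <-> jacobian_ideal S (f - g).
Proof.
split=> [/eqP|Jfg]; first by rewrite -Quotient.idealrBE => /in_jacobian_idealP.
by apply/eqP; rewrite -Quotient.idealrBE; apply/in_jacobian_idealP.
Qed.

Lemma jprojK S (u : jacobian S) : jproj S (repr u) = u.
Proof. exact: reprK. Qed.

Lemma jproj_repr S f : jacobian_ideal S (repr (jproj S f) - f).
Proof. by apply/jprojP; rewrite jprojK. Qed.

Lemma jprojB S f g : jproj S (f - g) = jproj S f - jproj S g.
Proof. exact: (raddfB (\pi_(Quotient.quot (in_jacobian_ideal S)))). Qed.

Lemma jprojD S f g : jproj S (f + g) = jproj S f + jproj S g.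
Proof. exact: (raddfD (\pi_(Quotient.quot (in_jacobian_ideal S)))). Qed.

Definition jac_one S : jacobian S := jproj S 1.
Definition jac_mul S (u v : jacobian S) : jacobian S := jproj S (repr u * repr v).

Lemma jprojM S f g : jac_mul (jproj S f) (jproj S g) = jproj S (f * g).
Proof.
apply/jprojP; set f' := repr _; set g' := repr _.
have -> : f' * g' - f * g = (f' - f) * g' - f * (g - g').
  by rewrite mulrBl mulrBr opprB addrA subrK.
apply: jacobian_idealB.
  by apply: jacobian_idealMr; apply: jproj_repr.
apply: jacobian_idealMl; rewrite -[g - g']opprB -[- _]add0r.
by apply: jacobian_idealB; [apply: jacobian_ideal0 | apply: jproj_repr].
Qed.

Lemma jac_mulA S : associative (@jac_mul S).
Proof.
by move=> u v w; rewrite -[u]jprojK -[v]jprojK -[w]jprojK !jprojM mulrA.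
Qed.
Lemma jac_mul1l S : left_id (jac_one S) (@jac_mul S).
Proof. by move=> u; rewrite -[u]jprojK jprojM mul1r. Qed.
Lemma jac_mul1r S : right_id (jac_one S) (@jac_mul S).
Proof. by move=> u; rewrite -[u]jprojK jprojM mulr1. Qed.
Lemma jac_mulDl S : left_distributive (@jac_mul S) +%R.
Proof.
move=> u v w; rewrite -[u]jprojK -[v]jprojK -[w]jprojK.
by rewrite -jprojD !jprojM -jprojD mulrDl.
Qed.
Lemma jac_mulDr S : right_distributive (@jac_mul S) +%R.
Proof.
move=> u v w; rewrite -[u]jprojK -[v]jprojK -[w]jprojK.
by rewrite -jprojD !jprojM -jprojD mulrDr.
Qed.

HB.instance Definition _ S := GRing.Zmodule_isPzRing.Build (jacobian S)
  (@jac_mulA S) (@jac_mul1l S) (@jac_mul1r S) (@jac_mulDl S) (@jac_mulDr S).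

Definition degree (d : arrow Q -> bool) p : nat := (\sum_(a <- parrows p) d a)%N.

(* A path p with S p != 0 is a cycle appearing in the potential S. *)
Definition admissible_cut S (d : arrow Q -> bool) : Prop :=
  (forall p, S p != 0 -> degree d p = 1%N) /\
  (forall a, (forall p, S p != 0 -> a \notin parrows p) -> d a = false).

Definition homogeneous d n f : Prop := forall p, f p != 0 -> degree d p = n.

Definition degree_zero S d : {pred jacobian S} :=
  fun u => `[< exists2 f, homogeneous d 0 f & u = jproj S f >].
Arguments degree_zero S d : clear implicits.

Lemma degree_zero_subring S d : subring_closed (degree_zero S d).
Proof.
split=> [|u v /asboolP[f f0 ->] /asboolP[g g0 ->]
         |u v /asboolP[f f0 ->] /asboolP[g g0 ->]].
- apply/asboolP; exists 1 => // p; rewrite /GRing.one /= /cpa_one /plen.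
  have [/size0nil e _|_] := eqVneq (size (parrows p)) 0%N.
    by rewrite /degree e big_nil.
  by rewrite eqxx.
- apply/asboolP; exists (f - g); last by rewrite jprojB.
  move=> p fg; case: (eqVneq (f p) 0) => [f_0|]; last exact: f0.
  case: (eqVneq (g p) 0) => [g_0|]; last exact: g0.
  by move: fg; rewrite [_ p](_ : _ = f p - g p) // f_0 g_0 subrr eqxx.
- apply/asboolP; exists (f * g); last by rewrite -jprojM.
  move=> p fg; apply/eqP/negPn/negP => dp; move/eqP: fg; case.
  apply: big1 => k _; apply/eqP; rewrite mulf_eq0 -implyNb; apply/implyP => fk.
  apply/negPn/negP => gk; move: dp.
  rewrite /degree -[parrows p](cat_take_drop k) big_cat /=.
  by move: (f0 _ fk) (g0 _ gk); rewrite /degree /parrows /= => -> ->.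
Qed.

HB.instance Definition _ S d :=
  GRing.isSubringClosed.Build (jacobian S) (degree_zero S d)
    (degree_zero_subring S d).

Record degree_zero_subalgebra S d := DegreeZero {
  dz_val : jacobian S;
  dz_valP : dz_val \in degree_zero S d }.

HB.instance Definition _ S d := [isSub for @dz_val S d].
HB.instance Definition _ S d := [Choice of degree_zero_subalgebra S d by <:].
HB.instance Definition _ S d :=
  GRing.SubChoice_isSubPzRing.Build (jacobian S) (degree_zero S d)
    (degree_zero_subalgebra S d) (degree_zero_subring S d).

Definition no_short_cycles S : Prop := forall p, (plen p <= 1)%N -> S p = 0.

Lemma ptriv_derivative_ideal S f v :
  no_short_cycles S -> derivative_ideal S f -> f (ptriv v) = 0.
Proof.
move=> hS [s ->].
elim: s => [|t s IH]; first by rewrite big_nil.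
rewrite big_cons [LHS](_ : _ = (t.1.1 * cyclic_derivative t.1.2 S * t.2) (ptriv v)
  + (\sum_(j <- s) j.1.1 * cyclic_derivative j.1.2 S * j.2) (ptriv v)) // IH addr0.
rewrite [LHS]big_ord1 [X in X * _]big_ord1.
suff -> : forall p, plen p = 0%N -> cyclic_derivative t.1.2 S p = 0.
- by rewrite mulr0 mul0r.
- by rewrite /plen /parrows /=.
move=> p p0; rewrite /cyclic_derivative; case: ifP => // _.
rewrite p0 big_ord1 /coef; case: insubP => // q _ qE; apply: hS.
rewrite /plen /parrows qE /= size_cat /= /parrows /=.
by rewrite (size0nil p0).
Qed.

Lemma ptriv_jacobian_ideal S f v :
  no_short_cycles S -> jacobian_ideal S f -> f (ptriv v) = 0.
Proof.
move=> hS /(_ 1%N)[g Ig fg]; rewrite fg //; exact: ptriv_derivative_ideal Ig.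
Qed.

(* The simple module at the vertex i: the one-dimensional space K, on which an
   element of Lambda acts as its coefficient at the trivial path at i (this is
   where no_short_cycles is needed). As a representation it is K at i and 0 at
   the other vertices. *)
Definition simple_module S (hS : no_short_cycles S) (d : arrow Q -> bool)
  (i : vertex Q) : Type := K.

Section SimpleModule.
Variables (S : cpa K Q) (hS : no_short_cycles S) (d : arrow Q -> bool).
Variable i : vertex Q.
Local Notation Lam := (degree_zero_subalgebra S d).
Local Notation M := (simple_module hS d i).

HB.instance Definition _ := GRing.Zmodule.copy M K.

Definition simple_scale (l : Lam) (x : M) : M :=
  (repr (val l) (ptriv i) : K) * (x : K).

Lemma repr_ptriv f : repr (jproj S f) (ptriv i) = f (ptriv i).
Proof.
apply/eqP; rewrite -subr_eq0; apply/eqP.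
exact: (ptriv_jacobian_ideal i hS (jproj_repr S f)).
Qed.

Lemma simple_scaleA l m (x : M) :
  simple_scale l (simple_scale m x) = simple_scale (l * m) x.
Proof.
rewrite /simple_scale mulrA; congr (_ * _).
have -> : val (l * m) = jproj S (repr (val l) * repr (val m)) by exact: rmorphM.
rewrite repr_ptriv [RHS]big_ord1.
by congr (_ * _); congr (repr (val _) _); apply: qpath_eq.
Qed.

Lemma simple_scale1 : left_id 1 simple_scale.
Proof.
move=> x; rewrite /simple_scale.
have -> : val (1 : Lam) = jproj S 1 by exact: rmorph1.
by rewrite repr_ptriv mul1r.
Qed.

Lemma simple_scaleDr : right_distributive simple_scale +%R.
Proof. by move=> l x y; rewrite /simple_scale mulrDr. Qed.

Lemma simple_scaleDl x : {morph simple_scale^~ x : l m / l + m}.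
Proof.
move=> l m; rewrite /simple_scale.
have -> : val (l + m) = jproj S (repr (val l) + repr (val m)).
  by rewrite jprojD !jprojK; exact: rmorphD.
by rewrite repr_ptriv mulrDl.
Qed.

HB.instance Definition _ := GRing.Zmodule_isLmodule.Build Lam M
  simple_scaleA simple_scale1 simple_scaleDr simple_scaleDl.

End SimpleModule.

End JacobianAlgebra.

(* An ideal triangulation, given by the gluing of its triangles. Each element
   of side is a side of one triangle; cw x is the side following x clockwise
   along the boundary of that triangle, so that triangles are the orbits of
   cw. If opp x != x, then x is glued with opp x, reversing the directions in
   which the clockwise orientations of the two triangles traverse them (the
   surface is oriented), and {x, opp x} is an arc; if opp x = x, then x is a
   boundary segment. The surface is the space obtained by the gluing, and its
   marked points are the images of the vertices of the triangles. A self-folded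
   triangle is one with opp (cw x) = x, whose corner at the end of x is a
   puncture of valency 1; the once-punctured monogon has no other
   triangulation. The disc with three marked points is the case of a single
   triangle without arcs. *)
Record triangulation := Triangulation {
  side : finType;
  cw : side -> side;
  opp : side -> side;
  cw_cw_cw : forall x, cw (cw (cw x)) = x;
  cw_neq : forall x, cw x != x;
  opp_opp : involutive opp;
  surface_connected :
    forall x y, connect (fun u v => (v == cw u) || (v == opp u)) x y }.

Section Triangulation.
Variable tau : triangulation.
Local Notation side := (side tau).
Implicit Types (x y : side) (P T : {set side}).

Definition inner x : bool := opp x != x.

Definition has_boundary : Prop := exists x, ~~ inner x.

Definition arc_set : {set {set side}} := [set [set x; opp x] | x in inner].
Definition arc := {e : {set side} | e \in arc_set}.

Lemma arc_of_subproof x : inner x -> [set x; opp x] \in arc_set.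
Proof. exact: imset_f. Qed.

Definition arc_of x (ix : inner x) : arc :=
  exist (fun e => e \in arc_set) _ (arc_of_subproof ix).

(* The side x also stands for the corner of its triangle between x and cw x.
   Crossing the arc cw x counterclockwise around the marked point of this
   corner leads to the corner opp (cw x). *)
Definition turn x := opp (cw x).

Definition adjacent_corners : rel side :=
  fun x y => inner (cw x) && (y == turn x) || inner (cw y) && (x == turn y).

(* The marked point at the corner x, as the set of its corners. *)
Definition marked_point x : {set side} := [set y | connect adjacent_corners x y].

Definition marked_points : {set {set side}} := [set marked_point x | x : side].

(* The sides meeting at the corner x are x and cw x; a marked point is a
   puncture iff no boundary segment ends there. *)
Definition punctures : {set {set side}} :=
  [set P in marked_points | [forall x in P, inner x && inner (cw x)]].

Definition at_puncture x : bool := marked_point x \in punctures.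

(* Each arc has two ends, the ends of its two sides x and opp x traversed
   clockwise, and the end of a side x is at the corner x. *)
Definition valency P : nat := #|[set x in P | inner x]|.

Definition valency_ge3 : Prop := forall P, P \in punctures -> (3 <= valency P)%N.

Definition tri_arrow := {x : side | inner x && inner (cw x)}.

Definition arrow_source (a : tri_arrow) : arc :=
  arc_of (proj1 (andP (valP a))).
Definition arrow_target (a : tri_arrow) : arc :=
  arc_of (proj2 (andP (valP a))).

Definition tri_quiver : quiver :=
  @Quiver arc tri_arrow arrow_source arrow_target.

Definition internal x : bool := [&& inner x, inner (cw x) & inner (cw (cw x))].

Definition internal_triangles : {set {set side}} :=
  [set [set x; cw x; cw (cw x)] | x in internal].

(* The list of the elements of a cycle C of the permutation s, from an arbitrary
   starting point (cyclic derivatives do not depend on the starting point of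
   a cycle). *)
Definition cycle_word (s : side -> side) (C : {set side}) : seq side :=
  if [pick x in C] is Some x then orbit s x else [::].

Variables (K : fieldType) (weight : {set side} -> K).

Definition potential : cpa K tri_quiver := fun p =>
  let w := map val (parrows p) in
  \sum_(T in internal_triangles) (w == cycle_word (@cw tau) T)%:R
  + \sum_(P in punctures) weight P * (w == cycle_word turn P)%:R.

Lemma opp_inj : injective (@opp tau).
Proof. exact: inv_inj (@opp_opp tau). Qed.

Lemma cw_inj : injective (@cw tau).
Proof. by move=> x y e; rewrite -(cw_cw_cw x) e cw_cw_cw. Qed.

Lemma turn_inj : injective turn.
Proof. by move=> x y /opp_inj/cw_inj. Qed.

Lemma size_orbit_gt1 (s : side -> side) x :
  s x != x -> (1 < size (orbit s x))%N.
Proof.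
move=> sx; rewrite size_orbit /order.
apply: (@leq_trans #|[set x; s x]|); first by rewrite cards2 eq_sym sx.
apply/subset_leq_card/subsetP => y; rewrite !inE => /orP[]/eqP->.
  exact: connect0.
exact: fconnect1.
Qed.

Lemma size_triangle_word T :
  T \in internal_triangles -> (1 < size (cycle_word (@cw tau) T))%N.
Proof.
case/imsetP=> x _ ->; rewrite /cycle_word; case: pickP => [y _|/(_ x)].
  exact: size_orbit_gt1 (cw_neq y).
by rewrite !inE eqxx.
Qed.

Lemma turn_fixed x : turn x = x -> marked_point x \subset [set x].
Proof.
move=> tx; apply/subsetP => y; rewrite !inE => /connectP[s + ->] {y}.
elim: s => [|z s IH] //=; case/andP=> xz xs.
suff zx : z = x by move: xs; rewrite zx => /IH.
case/orP: xz => /andP[_ /eqP]; first by rewrite tx.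
by move=> e; apply: turn_inj; rewrite -e.
Qed.

Lemma size_puncture_word P : valency_ge3 -> P \in punctures ->
  (1 < size (cycle_word turn P))%N.
Proof.
move=> val3 Ppun; have := val3 _ Ppun; move: (Ppun).
rewrite inE => /andP[/imsetP[x _ ->] _].
rewrite /cycle_word; case: pickP => [y|/(_ x)]; last by rewrite inE connect0.
rewrite inE => xy valP; apply: size_orbit_gt1; apply/eqP => /turn_fixed sub.
have sym : connect_sym adjacent_corners.
  by apply: sym_connect_sym => u v; rewrite /adjacent_corners orbC.
have e : marked_point x = marked_point y.
  by apply/setP => z; rewrite !inE (same_connect sym xy).
have : (valency (marked_point x) <= #|[set y]|)%N.
  apply: subset_leq_card; apply: subset_trans sub; rewrite -e.
  by apply/subsetP => z; rewrite inE => /andP[].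
by rewrite cards1 => /(leq_trans valP).
Qed.

Lemma potential_no_short_cycles : valency_ge3 -> no_short_cycles potential.
Proof.
move=> val3 p p1; rewrite /potential.
have ne w : (1 < size w)%N -> (map val (parrows p) == w) = false.
  move=> w1; apply/eqP => e; move: p1; rewrite /plen -(size_map val) e.
  by rewrite leqNgt w1.
rewrite !big1 ?addr0 // => [P|T] h; rewrite ne ?mulr0 //.
  exact: size_puncture_word.
exact: size_triangle_word.
Qed.

Variable d : arrow tri_quiver -> bool.

Definition degree_one x : Prop := exists2 a : tri_arrow, val a = x & d a.

(* x, cw x and cw (cw x) are the sides of the triangle lying on the arcs i, j
   and k; B is the corner cw x, the arrow k -> i sits at the corner
   cw (cw x). The other triangle at j has the sides y on j, then a boundary
   segment, then cw (cw y) on m; y starts where cw x ends, that is, at B. *)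
Definition configuration_I (i : arc) : Prop :=
  exists x, [/\ x \in val i, internal x, at_puncture (cw x),
    degree_one (cw (cw x)) &
    let y := opp (cw x) in
    [/\ ~~ inner (cw y), inner (cw (cw y)) & degree_one (cw (cw y))]].

(* z and cw z are the sides of the triangle lying on the arcs k and i; the
   arrow k -> i sits at the corner z. In the other triangle at k, with side
   opp z on k, the corner opposite to k is cw (opp z). *)
Definition configuration_II (i : arc) : Prop :=
  exists z, [/\ cw z \in val i, inner z && ~~ inner (cw (cw z)), at_puncture z,
    degree_one z &
    let y := opp z in internal y /\ degree_one (cw y)].

End Triangulation.

(* Main.v *)
(* Lambda is finite dimensional: two consecutive arrows of a triangle form one
   side of a relation, so they can be replaced by a path turning around a
   puncture (or by 0), and a longer path containing such a pair is rewritten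
   into longer and longer ones; these have length 3 forever only on the
   tetrahedral triangulation of the closed sphere, and vanish in Lambda
   otherwise. Hence the paths which turn around a single marked point, those
   which complete a cut arrow of a non-internal triangle excepted, form a basis
   together with the trivial paths.

   The relations starting at i = {s, opp s} come from the cut arrows ending at
   i, one possible at each side of i, and comparing first arrows in the ideal of
   relations gives an exact sequence P2 -> P1 -> P0 -> S(i) -> 0, where P2 is the
   sum of the projectives at the sources of these cut arrows. The kernel of
   P2 -> P1 lies in the radical of P2, so if it is not 0 it is not a direct
   summand and the projective dimension is at least 3. In the above basis the
   kernel is seen to be 0 except in the configurations (I) and (II), again
   because the surface is not a sphere triangulated by a tetrahedron. *)

Require Import Defs.
From HB Require Import structures.
From mathcomp Require Import all_boot all_order all_algebra.
From mathcomp Require Import zify.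
From mathcomp Require Import generic_quotient.
From mathcomp Require Import boolp reals complex.
Import Defs.

Set Implicit Arguments.
Unset Strict Implicit.
Unset Printing Implicit Defensive.

Import GRing.Theory.

Local Open Scope ring_scope.

(** * Left ideals generated by idempotents *)

(** Independence of paths is read off from coefficients in the ideal itself. In a product
    [A * cyclic_derivative a S * B], at a path containing no term of the derivative as a proper
    subpath, only the constant parts of A and B contribute. So an element of the ideal has
    coefficient 0 at an uncut turning path, unless a cut arrow completes this path to the cycle of a
    puncture; then its coefficient is tied to that of the other term of the relation, when there is
    one. Elements of Lambda are classes of infinite series, so vanishing cannot be checked path by
    path by linearity alone. Long words being 0, it is enough to remove first arrows finitely often.
    The operator doing this is a derivation up to a twist, and modulo the ideal it retains from such
    a product only A, the constant part of B and the relation without its first arrow. An arc has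
    two sides [s] and [opp s]; statements are made at one side and applied to both. A missing arrow
    or relation is given the idempotent 0, so that one resolution serves all positions of the arc
    relative to the boundary. *)

Section LeftIdeal.
Variables (A : pzRingType) (e : A).

(** For an idempotent [e] this is the left ideal generated by [e]; for [e = 0] it is the zero
    module. *)
Definition fixed_by : {pred A} := fun u => u * e == u.

Lemma fixed_by_zmod : zmod_closed fixed_by.
Proof.
split=> [|u v /eqP eu /eqP ev]; first by rewrite unfold_in mul0r.
by rewrite unfold_in mulrBl eu ev.
Qed.

HB.instance Definition _ := GRing.isZmodClosed.Build A fixed_by fixed_by_zmod.

Record left_ideal := LeftIdeal { li_val : A; li_valP : li_val \in fixed_by }.

HB.instance Definition _ := [isSub for li_val].
HB.instance Definition _ := [Choice of left_ideal by <:].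
HB.instance Definition _ := [SubChoice_isSubZmodule of left_ideal by <:].

Lemma li_scale_subproof (a : A) (u : left_ideal) : a * val u \in fixed_by.
Proof. by rewrite unfold_in -mulrA (eqP (valP u)). Qed.

Definition li_scale a u : left_ideal := LeftIdeal (li_scale_subproof a u).

Lemma li_scaleA a b u : li_scale a (li_scale b u) = li_scale (a * b) u.
Proof. by apply: val_inj; rewrite /= mulrA. Qed.
Lemma li_scale1 : left_id 1 li_scale.
Proof. by move=> u; apply: val_inj; rewrite /= mul1r. Qed.
Lemma li_scaleDr : right_distributive li_scale +%R.
Proof. by move=> a u v; apply: val_inj; rewrite /= mulrDr. Qed.
Lemma li_scaleDl u : {morph li_scale^~ u : a b / a + b}.
Proof. by move=> a b; apply: val_inj; rewrite /= mulrDl. Qed.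

HB.instance Definition _ := GRing.Zmodule_isLmodule.Build A left_ideal
  li_scaleA li_scale1 li_scaleDr li_scaleDl.

Lemma li_valZ a (u : left_ideal) : val (a *: u) = a * val u.
Proof. by []. Qed.

Lemma li_valM (u : left_ideal) : val u * e = val u.
Proof. exact: eqP (valP u). Qed.

Lemma li_val0 (u : left_ideal) : e = 0 -> val u = 0.
Proof. by move/(congr1 ( *%R (val u))); rewrite li_valM mulr0. Qed.

Section Lift.
Variables (M : lmodType A) (m : M).

Definition li_lift (u : left_ideal) : M := val u *: m.

Lemma li_lift_linear : linear li_lift.
Proof. by move=> a u v; rewrite /li_lift scalerDl scalerA. Qed.

HB.instance Definition _ :=
  GRing.isLinear.Build A left_ideal M *:%R li_lift li_lift_linear.
End Lift.

Hypothesis ee : e * e = e.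

Lemma li_gen_subproof : e \in fixed_by. Proof. exact/eqP. Qed.
Definition li_gen : left_ideal := LeftIdeal li_gen_subproof.

Lemma li_genE (u : left_ideal) : u = val u *: li_gen.
Proof. by apply: val_inj; rewrite li_valZ /= li_valM. Qed.

Lemma left_ideal_projective : projective left_ideal.
Proof.
move=> M N g f surj; have [m gm] := surj (f li_gen).
by exists (li_lift m) => u; rewrite linearZ gm -linearZ -li_genE.
Qed.

End LeftIdeal.

Lemma linear_bundle (A : pzRingType) (U V : lmodType A) (f : U -> V) :
  linear f -> exists g : {linear U -> V}, forall x, g x = f x.
Proof.
move=> lin.
by pose g : {linear U -> V} := HB.pack f (GRing.isLinear.Build _ _ _ _ _ lin);
  exists g.
Qed.

Lemma linear_row (A : pzRingType) (U1 U2 W : lmodType A)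
    (f1 : {linear U1 -> W}) (f2 : {linear U2 -> W}) :
  exists g : {linear (U1 * U2)%type -> W}, forall u, g u = f1 u.1 + f2 u.2.
Proof.
by apply: linear_bundle => a u v; rewrite !linearP /= scalerDr addrACA.
Qed.

Lemma linear_matrix (A : pzRingType) (U1 U2 W1 W2 : lmodType A)
    (f11 : {linear U1 -> W1}) (f21 : {linear U2 -> W1})
    (f12 : {linear U1 -> W2}) (f22 : {linear U2 -> W2}) :
  exists g : {linear (U1 * U2)%type -> (W1 * W2)%type},
    forall u, g u = (f11 u.1 + f21 u.2, f12 u.1 + f22 u.2).
Proof.
apply: linear_bundle => a u v; rewrite !linearP /=.
by congr pair; rewrite addrACA -scalerDr.
Qed.

(** * Projective modules and comparison of resolutions *)

Section Kernel.
Variables (A : pzRingType) (L K : lmodType A) (h : {linear L -> K}).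

Definition kernel_pred : {pred L} := fun y => h y == 0.

Lemma kernel_submod : submod_closed kernel_pred.
Proof.
split=> [|a u v]; rewrite !unfold_in ?linear0 // => /eqP hu /eqP hv.
by rewrite linearP hu hv scaler0 addr0.
Qed.

HB.instance Definition _ := GRing.isSubmodClosed.Build A L kernel_pred
  kernel_submod.

Record kernel := Kernel { ker_val : L; ker_valP : ker_val \in kernel_pred }.

HB.instance Definition _ := [isSub for ker_val].
HB.instance Definition _ := [Choice of kernel by <:].
HB.instance Definition _ := [SubChoice_isSubLmodule of kernel by <:].

(** Both maps corestrict to the kernel of [h], where exactness makes the one from [N] surjective, so
    that projectivity of [P] applies. *)
Lemma projective_lift (P N : lmodType A) (f : {linear P -> L})
    (g : {linear N -> L}) :
  projective P -> (forall x, h x = 0 <-> exists y, g y = x) ->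
  (forall x, h (f x) = 0) -> exists u : {linear P -> N}, forall x, g (u x) =
    f x.
Proof.
move=> pP ex hf.
have hg y : h (g y) = 0 by apply/ex; exists y.
pose f' x := Kernel (introT eqP (hf x) : f x \in kernel_pred).
pose g' x := Kernel (introT eqP (hg x) : g x \in kernel_pred).
have f'_lin : linear f' by move=> a x y; apply: val_inj; rewrite /= linearP.
have g'_lin : linear g' by move=> a x y; apply: val_inj; rewrite /= linearP.
have [f1 f1E] := linear_bundle f'_lin; have [g1 g1E] := linear_bundle g'_lin.
have [y|u uE] := pP _ _ g1 f1.
  have /ex[x gx] : h (val y) = 0 by exact: eqP (valP y).
  by exists x; rewrite g1E; apply: val_inj.
by exists u => x; have /(congr1 val) := uE x; rewrite f1E g1E.
Qed.

End Kernel.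

Section Projective.
Variable A : pzRingType.

Lemma projective0 (P : lmodType A) : (forall x : P, x = 0) -> projective P.
Proof.
move=> P0 M N g f _; exists (\0 : {linear P -> M}) => x.
by rewrite [x]P0 !linear0.
Qed.

Lemma projective_prod (P1 P2 : lmodType A) :
  projective P1 -> projective P2 -> projective (P1 * P2)%type.
Proof.
move=> pP1 pP2 M N g f surj.
have lin1 : linear (fun x : P1 => f (x, 0)).
  by move=> a x y; rewrite -linearP /=; congr (f _); congr pair;
    rewrite /= ?scaler0 ?addr0.
have lin2 : linear (fun x : P2 => f (0, x)).
  by move=> a x y; rewrite -linearP /=; congr (f _); congr pair;
    rewrite /= ?scaler0 ?addr0.
have [f1 f1E] := linear_bundle lin1; have [f2 f2E] := linear_bundle lin2.
have [h1 h1E] := pP1 M N g f1 surj; have [h2 h2E] := pP2 M N g f2 surj.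
have [h hE] := linear_row h1 h2; exists h => -[x y].
rewrite hE linearD /= h1E h2E f1E f2E -linearD.
by congr (f _); congr pair; rewrite /= ?addr0 ?add0r.
Qed.

Variables (M P0 P1 P2 : lmodType A).
Variables (e : {linear P0 -> M}) (d1 : {linear P1 -> P0}) (d2 : {linear P2 ->
  P1}).
Hypothesis pP : [/\ projective P0, projective P1 & projective P2].
Hypothesis surj : forall y, exists x, e x = y.
Hypothesis exact0 : forall x, e x = 0 <-> exists y, d1 y = x.
Hypothesis exact1 : forall x, d1 x = 0 <-> exists y, d2 y = x.

Lemma resolution_length2 :
  (forall x, d2 x = 0 -> x = 0) -> projective_resolution_of_length M 2.
Proof.
case: pP => pP0 pP1 pP2 inj.
pose Z : lmodType A := left_ideal (0 : A).
have Z0 (x : Z) : x = 0 by apply: val_inj; rewrite -li_valM mulr0.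
pose P k : lmodType A :=
  match k with 0 => P0 | 1 => P1 | 2 => P2 | _ => Z end.
pose d k : {linear P k.+1 -> P k} :=
  match k with 0 => d1 | 1 => d2 | 2 => \0 | _ => \0 end.
exists P, d, e; split=> //.
- by case=> [|[|[|k]]] //; exact: projective0.
- by case=> [|[|[|k]]].
- case=> [|[|[|k]]] x //=; split=> [x0|[y <-]] //.
  + by exists 0; rewrite (inj _ x0).
  + exact: linear0.
Qed.

(* If M has projective dimension at most 2, the second syzygy is projective,
   so the kernel of d2 is a direct summand of P2. *)
Lemma projection_on_kernel m :
  (m < 3)%N -> projective_resolution_of_length M m ->
  exists u : {linear P2 -> P2},
    (forall x, d2 (u x) = 0) /\ (forall x, d2 x = 0 -> u x = x).
Proof.
case: pP => pP0 pP1 pP2.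
move=> m3 [Q [q [eQ [pQ Q0 surjQ exQ0 exQ]]]].
have q_inj x : q 1%N x = 0 -> x = 0.
  by case/exQ=> y <-; rewrite (Q0 _ m3 y) linear0.
have d21 x : d1 (d2 x) = 0 by apply/exact1; exists x.
have d10 x : e (d1 x) = 0 by apply/exact0; exists x.
have q21 x : q 0%N (q 1%N x) = 0 by apply/exQ; exists x.
have q10 x : eQ (q 0%N x) = 0 by apply/exQ0; exists x.
(* The chain maps [f] from P to Q and [g] from Q to P lift the identity of [M]. *)
have [f0 f0E] := pP0 _ _ eQ e surjQ.
have [x|f1 f1E] := projective_lift (h := eQ) (f := f0 \o d1) pP1 exQ0.
  by rewrite /= f0E d10.
have [x|f2 f2E] := projective_lift (h := q 0%N) (f := f1 \o d2) pP2 (exQ 0%N).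
  by rewrite /= f1E /= d21 linear0.
have [g0 g0E] := pQ 0%N _ _ e eQ surj.
have [x|g1 g1E] := projective_lift (h := e) (f := g0 \o q 0%N) (pQ 1%N) exact0.
  by rewrite /= g0E q10.
have [x|g2 g2E] := projective_lift (h := d1) (f := g1 \o q 1%N) (pQ 2%N) exact1.
  by rewrite /= g1E /= q21 linear0.
(* [h0] and [h1] form a homotopy between [g \o f] and the identity in degrees 0 and 1. In degree 2
   the failure of [h1 \o d2] to complete it is the projection; on the kernel of [d2] it is the
   identity, because injectivity of [q 1] forces [f2 x = 0]. *)
have [x|h0 h0E] := projective_lift (h := e) (f := (g0 \o f0) \- idfun) pP0
  exact0.
  by rewrite /= linearB /= g0E f0E subrr.
have [x|h1 h1E] :=
  projective_lift (h := d1) (f := (g1 \o f1) \- idfun \- (h0 \o d1)) pP1 exact1.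
  by rewrite /= !linearB /= g1E /= f1E h0E /= subrr.
exists (idfun \+ (h1 \o d2) \- (g2 \o f2)); split=> x /=.
  by rewrite linearB linearD /= h1E g2E /= f2E /= d21 linear0 subr0 [d2 x +
    _]addrC subrK subrr.
move=> d2x; suff -> : f2 x =
  0 by rewrite d2x (linear0 h1) (linear0 g2) oppr0 !addr0.
by apply: q_inj; rewrite f2E /= d2x linear0.
Qed.

End Projective.

(** * Corners around a marked point *)

Section Corners.
Variable tau : triangulation.
Implicit Types x y z : side tau.

Local Notation cw := (@cw tau).
Local Notation opp := (@opp tau).
Local Notation turn := (@turn tau).

Lemma turn_cw2 x : turn (cw (cw x)) = opp x.
Proof. by rewrite /turn cw_cw_cw. Qed.

Lemma opp_turn x : opp (turn x) = cw x.
Proof. exact: opp_opp. Qed.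

Lemma inner_opp x : inner (opp x) = inner x.
Proof. by rewrite /inner opp_opp eq_sym. Qed.

Lemma cw2_neq x : cw (cw x) != x.
Proof. by apply/eqP => e; have := cw_neq (cw (cw x));
  rewrite cw_cw_cw e eqxx. Qed.

Lemma internal_cw x : internal (cw x) = internal x.
Proof. by rewrite /internal cw_cw_cw; case: inner; case: inner; case:
  inner. Qed.

(** A marked point is defined by crossing arcs in both directions. Since [turn] is a permutation of
    a finite set, forward orbits suffice: they either stay in the marked point or reveal a boundary
    segment ending there. *)
Lemma at_punctureP x :
  reflect (forall y, fconnect turn x y -> inner y &&
    inner (cw y)) (at_puncture x).
Proof.
rewrite /at_puncture inE imset_f //=.
have sub y : fconnect turn x y -> connect (@adjacent_corners tau) x y \/
    exists2 z, connect (@adjacent_corners tau) x z & ~~ inner (cw z).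
  case/connectP => p + ->; elim/last_ind: p => [|p z IH] /=; first by left.
  rewrite rcons_path last_rcons => /andP[/IH + /eqP <-].
  case=> [xz|]; last by right.
  have [iz|niz] := boolP (inner (cw (last x p))); last by right;
    exists (last x p).
  left; apply: connect_trans xz (connect1 _).
  by rewrite /adjacent_corners iz eqxx.
apply: (iffP forall_inP) => [H y xy|H y].
  have [xy'|[z xz niz]] := sub _ xy; first by apply: H; rewrite inE.
  have /H : z \in marked_point x by rewrite inE.
  by rewrite (negPf niz) andbF.
rewrite inE => /connectP[p + ->] {y}.
elim/last_ind: p => [|p z IH] /=.
  by move=> _; apply: H.
rewrite rcons_path last_rcons => /andP[xp].
suff conn q : path (@adjacent_corners tau) x q -> fconnect turn x (last x q).
  move=> adj; apply: H; rewrite -(last_rcons x p z); apply: conn.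
  by rewrite rcons_path xp.
elim/last_ind: q => [|q w IHq] //=;
  rewrite rcons_path last_rcons => /andP[/IHq xq].
case/orP=> /andP[_ /eqP e].
  by apply: connect_trans xq (connect1 _); rewrite /= e.
rewrite (same_fconnect1_r (@turn_inj tau)) -e //.
Qed.

Lemma at_puncture_inner x : at_puncture x -> inner x /\ inner (cw x).
Proof. by move/at_punctureP/(_ x (connect0 _ _))/andP. Qed.

Lemma at_puncture_connect x y :
  fconnect turn x y -> at_puncture x = at_puncture y.
Proof.
move=> xy; have e := same_connect (fconnect_sym (@turn_inj tau)) xy.
by apply/at_punctureP/at_punctureP => H z; [rewrite -e | rewrite e]; apply: H.
Qed.

Lemma at_puncture_turn x : at_puncture (turn x) = at_puncture x.
Proof. by apply/esym/at_puncture_connect; apply: fconnect1. Qed.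

Lemma marked_point_puncture x : at_puncture x ->
  marked_point x = [set y | fconnect turn x y].
Proof.
move=> /at_punctureP px; apply/setP => y; rewrite !inE.
apply/idP/idP => /connectP[p xp ->].
  elim/last_ind: p xp => [|p z IH] //=.
  rewrite rcons_path last_rcons => /andP[/IH xq].
  case/orP=> /andP[_ /eqP e]; first by apply: connect_trans xq (connect1 _);
    rewrite /= e.
  by rewrite (same_fconnect1_r (@turn_inj tau)) -e.
elim/last_ind: p xp => [|p z IH] //=.
rewrite rcons_path last_rcons => /andP[xp /eqP <-].
apply: connect_trans (IH xp) (connect1 _).
have /px/andP[_ i] : fconnect turn x (last x p) by apply/connectP; exists p.
by rewrite /adjacent_corners i eqxx.
Qed.

Lemma order_puncture x : valency_ge3 tau -> at_puncture x ->
  (3 <= order turn x)%N.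
Proof.
move=> val3 px; have := val3 _ px.
rewrite /valency marked_point_puncture // /order => v3; apply: leq_trans v3 _.
by apply/subset_leq_card/subsetP => y; rewrite !inE => /andP[].
Qed.

Lemma iter_turn x n : at_puncture x -> order turn x = n -> iter n turn x = x.
Proof. by move=> _ <-; apply: iter_order; apply: turn_inj. Qed.

(* Three mutually adjacent punctures of valency 3 force the triangulation of
   the sphere by the faces of a tetrahedron. *)
Lemma three_punctures_of_valency3 y :
    at_puncture (cw (cw y)) -> order turn (cw (cw y)) = 3 ->
    at_puncture (cw (cw (opp y))) -> order turn (cw (cw (opp y))) = 3 ->
    at_puncture (cw (opp y)) -> order turn (cw (opp y)) = 3 ->
  ~ has_boundary tau.
Proof.
move=> py oy pz oz pt ot [b nib].
have := iter_turn pt ot; have := iter_turn pz oz; have := iter_turn py oy.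
rewrite /= !turn_cw2 opp_opp.
set o := opp y; set t := turn o; set z := turn y => e1 e2.
rewrite -/t => e3.
have oppo : opp o = y by rewrite opp_opp.
have oppt : opp t = cw o by apply: opp_turn.
have oppz : opp z = cw y by apply: opp_turn.
have oppy'' : opp (cw (cw y)) = cw t by rewrite -e1 opp_turn.
have oppo'' : opp (cw (cw o)) = cw z by rewrite -[X in opp X]e2 opp_turn.
have ez : turn (cw o) = cw z by rewrite -oppo''.
have oppz'' : opp (cw (cw z)) = cw (cw t).
  move: e3; rewrite ez -[RHS]oppt => /opp_inj e.
  by rewrite -e cw_cw_cw.
have py' x : fconnect turn (cw (cw y)) x -> inner x &&
  inner (cw x) by move/at_punctureP: py; apply.
have pz' x : fconnect turn (cw (cw o)) x -> inner x &&
  inner (cw x) by move/at_punctureP: pz; apply.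
have pt' x : fconnect turn (cw o) x -> inner x &&
  inner (cw x) by move/at_punctureP: pt; apply.
have /andP[iy'' iy] := py' _ (connect0 _ _); rewrite cw_cw_cw in iy.
have /andP[io'' io] := pz' _ (connect0 _ _); rewrite cw_cw_cw in io.
have /andP[io' _] := pt' _ (connect0 _ _).
have /andP[it it'] : inner t && inner (cw t).
  by apply: py'; have := fconnect_iter turn 2 (cw (cw y)); rewrite /= turn_cw2.
have /andP[iz iz'] : inner z && inner (cw z).
  by apply: pz'; have := fconnect_iter turn 2 (cw (cw o));
    rewrite /= turn_cw2 oppo.
have iz'' : inner (cw (cw z)).
  by have /andP[] := pt' _ (fconnect1 _ _); rewrite ez.
have it'' : inner (cw (cw t)) by rewrite -oppz'' inner_opp.
have iy' : inner (cw y) by rewrite -oppz inner_opp.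
(* The sides of the faces of the tetrahedron. The three orbit equations close this list under [cw]
   and [opp], so by connectedness it contains every side, and all of its members are arcs. *)
pose s := [:: y; cw y; cw (cw y); o; cw o; cw (cw o); t; cw t; cw (cw t); z;
  cw z; cw (cw z)].
have s_inner x : x \in s -> inner x.
  by rewrite !inE; do ![case/orP]=> /eqP ->.
have s_closed x : x \in s -> (cw x \in s) && (opp x \in s).
  have oy' : opp (cw y) = z by [].
  have oo' : opp (cw o) = t by [].
  have ot' : opp (cw t) = cw (cw y) by rewrite -oppy'' opp_opp.
  have oz' : opp (cw z) = cw (cw o) by rewrite -oppo'' opp_opp.
  have ot'' : opp (cw (cw t)) = cw (cw z) by rewrite -oppz'' opp_opp.
  rewrite !inE; do ![case/orP]=> /eqP ->;
    rewrite ?cw_cw_cw -/o ?oppo ?oppt ?oppz ?oppy'' ?oppo'' ?oppz'';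
    rewrite ?oy' ?oo' ?ot' ?oz' ?ot'' !eqxx ?orbT //.
have : b \in s.
  have /connectP[p yp ->] := surface_connected y b.
  elim/last_ind: p yp => [|p x IH] /=; first by rewrite inE eqxx.
  rewrite rcons_path last_rcons => /andP[/IH/s_closed/andP[? ?]].
  by case/orP=> /eqP ->.
by move/s_inner; apply/negP.
Qed.

End Corners.

(** * The degree-zero subalgebra as a quotient of the complete path algebra *)

Section DegreeZeroPart.
Variables (K : fieldType) (Q : quiver) (S : cpa K Q) (d : arrow Q -> bool).
Implicit Types (f g : cpa K Q) (p : qpath Q).
Local Notation Lam := (degree_zero_subalgebra S d).

Lemma cpa0E p : (0 : cpa K Q) p = 0. Proof. by []. Qed.
Lemma cpaDE f g p : (f + g) p = f p + g p. Proof. by []. Qed.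
Lemma cpaNE f p : (- f) p = - f p. Proof. by []. Qed.
Lemma cpaME f g p :
  (f * g) p = \sum_(k < (plen p).+1) f (pdrop k p) * g (ptake k p).
Proof. by []. Qed.
Lemma cpa1E p : (1 : cpa K Q) p = (plen p == 0%N)%:R. Proof. by []. Qed.

Lemma cpa_sumE I (r : seq I) (P : pred I) (F : I -> cpa K Q) p :
  (\sum_(i <- r | P i) F i) p = \sum_(i <- r | P i) F i p.
Proof. by elim/big_rec2: _ => // i u f _ <-. Qed.

Definition deg0 f : cpa K Q := fun p => if degree d p == 0%N then f p else 0.

Lemma degree_cat p k : degree d p =
  (degree d (pdrop k p) + degree d (ptake k p))%N.
Proof. by rewrite /degree -{1}[parrows p](cat_take_drop k) big_cat addnC. Qed.

Lemma deg0_homogeneous f : homogeneous d 0 (deg0 f).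
Proof. by move=> p; rewrite /deg0; have [//|_] := eqVneq (degree d p) 0%N;
  rewrite eqxx. Qed.

Lemma deg0_id f : homogeneous d 0 f -> deg0 f = f.
Proof.
move=> hf; apply: funext => p; rewrite /deg0; case: ifPn => // dp.
by apply/esym/eqP; apply: contraNT dp => /hf ->.
Qed.

Lemma deg0D f g : deg0 (f + g) = deg0 f + deg0 g.
Proof. by apply: funext => p; rewrite /deg0 !cpaDE; case: ifP;
  rewrite ?addr0. Qed.

Lemma deg0N f : deg0 (- f) = - deg0 f.
Proof. by apply: funext => p; rewrite /deg0 !cpaNE; case: ifP;
  rewrite ?oppr0. Qed.

Lemma deg0_0 : deg0 0 = 0.
Proof. by apply: funext => p; rewrite /deg0; case: ifP. Qed.

Lemma deg0M f g : deg0 (f * g) = deg0 f * deg0 g.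
Proof.
apply: funext => p; rewrite /deg0 !cpaME; case: ifP => [/eqP p0|p0].
  apply: eq_bigr => k _; move: (degree_cat p k); rewrite p0 => /esym/eqP.
  by rewrite addn_eq0 => /andP[-> ->].
rewrite big1 // => k _; move: p0; rewrite (degree_cat p k) addn_eq0.
by case: eqP => //= _; [move=> -> | rewrite mul0r]; rewrite ?mulr0.
Qed.

Lemma deg0_1 : deg0 1 = 1.
Proof.
apply: funext => p; rewrite /deg0 !cpa1E; case: ifP => // p0; case:
  eqP => // lp.
by move: p0; rewrite /degree (size0nil lp) big_nil.
Qed.

Lemma mk_subproof f : jproj S (deg0 f) \in @degree_zero K Q S d.
Proof. by apply/asboolP; exists (deg0 f) => //; apply: deg0_homogeneous. Qed.

(* The class of the degree-zero component of f. This extends to a ring morphism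
   defined on the whole complete path algebra, since degrees are nonnegative. *)
Definition mk f : Lam := DegreeZero (mk_subproof f).

Lemma dz_valD (u v : Lam) : val (u + v) = val u + val v.
Proof. exact: rmorphD. Qed.
Lemma dz_valM (u v : Lam) : val (u * v) = val u * val v.
Proof. exact: rmorphM. Qed.

Lemma mk_surj (u : Lam) : exists f, u = mk f.
Proof.
have /asboolP[f f0 uf] := valP u; exists f; apply: val_inj => /=.
by rewrite deg0_id.
Qed.

Lemma mkD f g : mk (f + g) = mk f + mk g.
Proof. by apply: val_inj; rewrite dz_valD /= deg0D jprojD. Qed.

Lemma mk0 : mk 0 = 0.
Proof. by apply: (addIr (mk 0)); rewrite -mkD !add0r. Qed.

Lemma mkN f : mk (- f) = - mk f.
Proof. by apply: (addIr (mk f)); rewrite -mkD !addNr mk0. Qed.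

Lemma mkM f g : mk (f * g) = mk f * mk g.
Proof. by apply: val_inj; rewrite dz_valM /= deg0M -jprojM. Qed.

Lemma mk1 : mk 1 = 1.
Proof.
have e1 : val (1 : Lam) = jproj S 1 by exact: rmorph1.
by apply: val_inj; rewrite e1 /= deg0_1.
Qed.

Lemma mk_eq f g : mk f = mk g <-> jacobian_ideal S (deg0 (f - g)).
Proof.
rewrite deg0D deg0N -jprojP; split=> [/(congr1 val)//|e].
exact: val_inj.
Qed.

Lemma mk_eq0 f : mk f = 0 <-> jacobian_ideal S (deg0 f).
Proof. by rewrite -mk0 mk_eq subr0. Qed.

Lemma mkB f g : mk (f - g) = mk f - mk g.
Proof. by rewrite mkD mkN. Qed.

Lemma mk_sum I (r : seq I) (P : pred I) F :
  mk (\sum_(i <- r | P i) F i) = \sum_(i <- r | P i) mk (F i).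
Proof. exact: (big_morph mk mkD mk0). Qed.

Definition order_ge n f := forall p, (plen p < n)%N -> f p = 0.

Lemma derivative_in_jacobian f : derivative_ideal S f -> jacobian_ideal S f.
Proof. by move=> If n; exists f. Qed.

(** The closure of the ideal enters here: a class with representatives of arbitrarily high order is
    0. *)
Lemma mk_closed f :
  (forall n, exists2 g, order_ge n g & mk f = mk g) -> mk f = 0.
Proof.
move=> H; apply/mk_eq0 => n; have [g gn /mk_eq] := H n.
move=> /(_ n)[h Ih hE]; exists h => // p pn; rewrite -hE //.
by rewrite /deg0 cpaDE cpaNE gn // subr0.
Qed.

End DegreeZeroPart.

(** * Cyclic words *)

Section CyclicWords.
Variables (T : finType) (s : T -> T).
Hypothesis s_inj : injective s.
Implicit Types (x y : T) (w : seq T).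

Lemma orbit_cons x : orbit s x = x :: traject s (s x) (order s x).-1.
Proof. by rewrite /orbit -orderSpred. Qed.

Lemma order_step x : order s (s x) = order s x.
Proof. by apply/eq_card => y; exact/esym/(same_fconnect1 s_inj). Qed.

Lemma rot_orbit k x : (k <= order s x)%N -> rot k (orbit s x) =
  orbit s (iter k s x).
Proof.
elim: k => [|k IH] kx; first by rewrite rot0.
rewrite rotS ?size_orbit // IH ?(ltnW kx) //= [in RHS]/orbit order_step.
rewrite orbit_cons rot1_cons -[order s _]orderSpred.
have := iter_order s_inj (iter k s x); rewrite -orderSpred iterSr => e.
by rewrite trajectSr e.
Qed.

Lemma orbit_inj x y : orbit s x = orbit s y -> x = y.
Proof. by rewrite !orbit_cons => -[]. Qed.

(* A cyclic derivative at x adds the coefficients of the words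
   drop k w ++ x :: take k w, that is, rot k.+1 (x :: w). *)
Lemma count_rotations (R : pzSemiRingType) x y w : fconnect s x y ->
  \sum_(k < (size w).+1) (rot k.+1 (x :: w) == orbit s y)%:R
    = (w == traject s (s x) (order s x).-1)%:R :> R.
Proof.
move=> xy.
have oxy : order s y = order s x.
  by apply/eq_card => z; exact/esym/(same_connect (fconnect_sym s_inj) xy).
case: eqP => [w_x|w_x]; last first.
  rewrite big1 // => k _; case: eqP => // e; case: w_x.
  have : fcycle s (x :: w) by rewrite -(rot_cycle k.+1) e (cycle_orbit s_inj).
  rewrite /= rcons_path => /andP[/fpathE -> _].
  by have := congr1 size e; rewrite size_rot size_orbit oxy /= => <-.
have xw : x :: w = orbit s x by rewrite orbit_cons w_x.
have sw : (size w).+1 = order s x by rewrite -size_orbit -xw.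
(* The rotations of the orbit word of [x] are the orbit words of [s x], [s (s x)] and so on; exactly
   one of them starts at [y]. *)
transitivity (\sum_(z <- traject s (s x) (order s x)) (z == y)%:R : R).
  rewrite sw (big_nth (s x)) size_traject big_mkord; apply: eq_bigr => k _.
  rewrite xw rot_orbit // nth_traject // -iterSr; congr (nat_of_bool _)%:R.
  by apply/eqP/eqP => [/orbit_inj|->].
rewrite -order_step -/(orbit s (s x)) (bigD1_seq y) ?orbit_uniq //=.
  by rewrite eqxx big1 ?addr0 // => z /negPf ->.
by rewrite -fconnect_orbit -(same_fconnect1 s_inj).
Qed.

Definition orbit_set x : {set T} := [set y | fconnect s x y].

End CyclicWords.

(** * Paths as words of corners *)

Section Words.
Variables (K : fieldType) (tau : triangulation).
Implicit Types (x y z : side tau) (w : seq (side tau)).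

Local Notation Q := (tri_quiver tau).
Local Notation cw := (@cw tau).
Local Notation opp := (@opp tau).
Local Notation turn := (@turn tau).
Implicit Types (p q : qpath Q) (v : arc tau) (f g : cpa K Q).

Definition word p : seq (side tau) := map val (parrows p).

Definition is_arrow x := inner x && inner (cw x).

(** Two arrows can follow the arrow at [x]: the next one in its triangle and the next one around its
    marked point. *)
Definition step x y := (y == cw x) || (y == turn x).

Lemma size_word p : size (word p) = plen p.
Proof. by rewrite size_map. Qed.

Lemma arcP v x : x \in val v -> inner x /\ val v = [set x; opp x].
Proof.
case: v => e /= /imsetP[y iy ->].
by rewrite !inE => /orP[]/eqP->; rewrite ?inner_opp ?opp_opp // [RHS]setUC.
Qed.

Lemma arc_inj v v' x : x \in val v -> x \in val v' -> v = v'.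
Proof. by move=> /arcP[_ e] /arcP[_ e']; apply: val_inj; rewrite /= e e'. Qed.

Lemma sourceE (a : arrow Q) v : (source a == v) = (val a \in val v).
Proof.
apply/eqP/idP => [<-|av]; first by rewrite !inE eqxx.
by apply: (arc_inj _ av); rewrite !inE eqxx.
Qed.

Lemma targetE (a : arrow Q) v : (target a == v) = (cw (val a) \in val v).
Proof.
apply/eqP/idP => [<-|av]; first by rewrite !inE eqxx.
by apply: (arc_inj _ av); rewrite !inE eqxx.
Qed.

Lemma step_arrows (a b : arrow Q) : step (val a) (val b) =
  (target a == source b).
Proof.
rewrite targetE !inE /step eq_sym; congr (_ || _).
by rewrite eq_sym (inv_eq (@opp_opp tau)).
Qed.

Lemma walkE v (s : seq (arrow Q)) : @walk Q v s =
  if s is a :: s' then (val a \in val v) &&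
    path step (val a) (map val s') else true.
Proof.
elim: s v => // a s IH v; rewrite [LHS]/= sourceE IH; congr (_ && _).
case: s {IH} => // b s; rewrite -sourceE eq_sym -step_arrows.
by [].
Qed.

Lemma word_is_arrow p : all is_arrow (word p).
Proof. by apply/allP => _ /mapP[a _ ->]; exact: (valP a). Qed.

Lemma word_cons p x w : word p = x ::
  w -> x \in val (pstart p) /\ path step x w.
Proof.
rewrite /word /pstart /parrows; case: p => -[v [|a s]] //= vs [<- <-].
by move: vs; rewrite -[_ && _]/(@walk Q v (a :: s)) walkE => /andP.
Qed.

Lemma path_of_word x w : all is_arrow (x :: w) -> path step x w ->
  exists p, word p = x :: w.
Proof.
move=> ar xw.
have [s sE] : exists s : seq (arrow Q), map val s = x :: w.
  elim: (x :: w) ar => [|y t IH] /=; first by exists [::].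
  by case/andP=> ay /IH[s <-]; exists (exist _ y ay :: s).
case: s sE => // a s [ax sw]; move: xw; rewrite -ax -sw => xw.
have ws : @walk Q (source a) (a :: s) by rewrite walkE -sourceE eqxx.
by exists (exist (fun u : vertex Q * seq (arrow Q) => walk u.1 u.2) (source a,
  a :: s) ws).
Qed.

Lemma word_inj p q : word p = word q -> pstart p = pstart q -> p = q.
Proof. by move=> /(inj_map val_inj) e1 e2; apply: qpath_eq. Qed.

Lemma word_inj_cons p q x w : word p = x :: w -> word q = x :: w -> p = q.
Proof.
move=> pw qw; apply: word_inj; first by rewrite pw qw.
by case: (word_cons pw) (word_cons qw) => xp _ [xq _]; apply: arc_inj xp xq.
Qed.

Lemma word_ptake k p : word (ptake k p) = take k (word p).
Proof. by rewrite /word map_take. Qed.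

Lemma word_pdrop k p : word (pdrop k p) = drop k (word p).
Proof. by rewrite /word map_drop. Qed.

Lemma pend_word p x w : word p = rcons w x -> cw x \in val (pend p).
Proof.
rewrite /word /pend /endpoint; case/lastP: (parrows p) => [|s a].
  by case: w.
by rewrite !map_rcons last_rcons => /rcons_inj[_ <-]; rewrite -targetE.
Qed.

(* This is 0 when w is not the word of a path, and the scalar k when w is empty
   (k times the sum of all trivial paths). *)
Definition mono (k : K) w : cpa K Q := fun p => k * (word p == w)%:R.

(* The idempotent of the arc with side x, and 0 if x is a boundary segment. *)
Definition vert x : cpa K Q :=
  fun p => ((plen p == 0%N) && (x \in val (pstart p)))%:R.

Lemma mulmonoE f k w p : (f * mono k w) p =
  if prefix w (word p) then f (pdrop (size w) p) * k else 0.
Proof.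
rewrite cpaME prefixE.
have [wp|pw] := leqP (size w) (plen p); last first.
  rewrite take_oversize ?size_word 1?ltnW //; case: eqP => [e|_].
    by move: pw; rewrite -e size_word ltnn.
  rewrite big1 // => j _; rewrite /mono word_ptake.
  case: eqP => [e|_]; rewrite ?mulr0 //; move: pw.
  have : (size w <= size (word p))%N by rewrite -e size_take_min geq_minr.
  by rewrite size_word leqNgt => /negPf ->.
rewrite (bigD1 (Ordinal (wp : size w < (plen p).+1)%N)) //= [X in _ + X]big1
  ?addr0.
  by rewrite /mono word_ptake; case: eqP => _; rewrite ?mulr1 ?mulr0.
move=> j jw; rewrite /mono word_ptake; case: eqP => [e|_]; rewrite ?mulr0 //.
case/eqP: jw; apply: val_inj => /=; rewrite -e size_takel // size_word.
by rewrite -ltnS.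
Qed.

Lemma mono_mul k k' w w' : mono k w * mono k' w' = mono (k * k') (w' ++ w).
Proof.
apply: funext => p; rewrite mulmonoE /mono word_pdrop; case: ifP => [|pre].
  case/prefixP=> t ->; rewrite drop_size_cat // eqseq_cat // eqxx /=.
  by rewrite mulrAC.
case: eqP => [e|]; last by rewrite mulr0.
by rewrite e prefix_prefix in pre.
Qed.

Lemma mulvertE f x p : (f * vert x) p = if x \in val (pstart p) then f p else 0.
Proof.
rewrite cpaME (bigD1 ord0) //= big1 ?addr0.
  rewrite /vert pdrop0 plen_ptake // /pstart /= ; by case: ifP;
    rewrite ?mulr1 ?mulr0.
move=> j; rewrite -val_eqE /= => j0; rewrite /vert plen_ptake;
  last by rewrite -ltnS.
by rewrite (negPf j0) mulr0.
Qed.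

Lemma vertmulE f x p : (vert x * f) p = if x \in val (pend p) then f p else 0.
Proof.
rewrite cpaME (bigD1 ord_max) //= big1 ?addr0.
  rewrite /vert ptake_full plen_pdrop subnn eqxx /= /pstart /= take_size.
  by rewrite -/(pend p); case: ifP => _; rewrite ?mul1r ?mul0r.
move=> j; rewrite -val_eqE /= => jp; rewrite /vert plen_pdrop subn_eq0.
by rewrite leqNgt ltn_neqAle jp -ltnS ltn_ord mul0r.
Qed.

Lemma vert_idem x : vert x * vert x = vert x.
Proof.
apply: funext => p; rewrite mulvertE; case: ifP => // xp.
by rewrite /vert xp andbF.
Qed.

Lemma mono1 : mono 1 [::] = 1.
Proof.
by apply: funext => p; rewrite /mono cpa1E mul1r -size_word size_eq0.
Qed.

Lemma mono0 w : mono 0 w = 0.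
Proof. by apply: funext => p; rewrite /mono mul0r. Qed.

Lemma monoN k w : mono (- k) w = - mono k w.
Proof. by apply: funext => p; rewrite cpaNE /mono mulNr. Qed.

(* The restriction of f to the paths with first arrow a, with a removed; it is
   a twisted derivation by strip_mul. *)
Definition strip (a : arrow Q) f : cpa K Q := fun p =>
  if target a == pstart p then coef f (source a) (a :: parrows p) else 0.

Lemma stripE (a : arrow Q) f p q :
  word q = val a :: word p -> target a = pstart p -> strip a f p = f q.
Proof.
rewrite /strip => qp ap; rewrite ap eqxx /coef.
have [aq _] := word_cons qp.
have qa : parrows q = a :: parrows p by apply: (inj_map val_inj).
have sq : source a = pstart q by apply/eqP; rewrite sourceE.
case: insubP => [u _ uE|/negP[]].
  by congr f; apply: val_inj; rewrite uE sq -qa /pstart /parrows; case: (val q).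
by rewrite sq -qa; exact: (valP q).
Qed.

Lemma path_cons (a : arrow Q) p : target a = pstart p ->
  exists q, word q = val a :: word p.
Proof.
move=> ap; have ws : walk (source a) (a :: parrows p).
  by apply/andP; split; [exact: eqxx | rewrite ap; exact: (valP p)].
by exists (exist (fun u : vertex Q * seq (arrow Q) => walk u.1 u.2) (source a,
  a :: parrows p) ws).
Qed.

Lemma strip_eq0 (a : arrow Q) f p : target a != pstart p -> strip a f p = 0.
Proof. by rewrite /strip => /negPf ->. Qed.

Definition trivial_part f : cpa K Q :=
  fun p => if plen p == 0%N then f p else 0.

Lemma strip_decomposition f :
  f = trivial_part f
      + \sum_(a : arrow Q) strip a f * mono 1 [:: val a].
Proof.
apply: funext => p; rewrite cpaDE cpa_sumE.
rewrite /trivial_part; case wp : (word p) => [|x w]; rewrite -size_word wp /=.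
  by rewrite big1 ?addr0 // => a _; rewrite mulmonoE wp.
case pa : (parrows p) => [|a s]; first by move: wp; rewrite /word pa.
have [ax sw] : val a = x /\ map val s = w by move: wp; rewrite /word pa => -[].
rewrite add0r (bigD1 a) //= big1 => [|b ba].
  rewrite addr0 mulmonoE wp ax /= eqxx prefix0s mulr1 (@stripE _ _ _ p) //.
    by rewrite word_pdrop wp ax /= drop0.
  by rewrite /pstart /= pa /= take0.
rewrite mulmonoE wp /= -ax (inj_eq val_inj); case: eqP => // e.
by rewrite e eqxx in ba.
Qed.

Lemma mono_nilE k f p : (mono k [::] * f) p = k * f p.
Proof.
rewrite cpaME (bigD1 ord_max) //= big1 ?addr0.
  by rewrite /mono ptake_full word_pdrop drop_oversize ?size_word // eqxx mulr1.
move=> j; rewrite -val_eqE /= => jp; rewrite /mono word_pdrop -size_eq0.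
rewrite size_drop size_word subn_eq0 leqNgt ltn_neqAle jp -ltnS ltn_ord.
by rewrite mulr0 mul0r.
Qed.

(** In [f * g] the path from [g] is travelled first, so it contains the first arrow unless it is
    trivial; in that case it is the trivial path at the source of [a], and [a] starts the path from
    [f]. *)
Lemma strip_mul (a : arrow Q) f g :
  strip a (f * g) =
    f * strip a g + mono (g (ptriv (source a))) [::] * strip a f.
Proof.
apply: funext => p; rewrite cpaDE mono_nilE.
have [ap|nap] := eqVneq (target a) (pstart p); last first.
  by rewrite !strip_eq0 // mulr0 addr0 cpaME big1 // => k _;
    rewrite strip_eq0 ?mulr0.
have [q qE] := path_cons ap.
have sq : source a = pstart q by apply/eqP; rewrite sourceE; case:
  (word_cons qE).
have aq : parrows q = a :: parrows p by apply: (inj_map val_inj).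
rewrite (stripE _ qE) // cpaME -size_word qE /= big_ord_recl /= addrC;
  congr (_ + _).
  rewrite cpaME size_word; apply: eq_bigr => k _; congr (f _ * _).
    apply: qpath_eq; last by rewrite /parrows /= -/(parrows q) aq.
    transitivity (endpoint (target a) (take k (parrows p))); last by rewrite ap.
    by rewrite /pstart /= -/(parrows q) aq.
  symmetry; apply: stripE; last by [].
  by rewrite !word_ptake qE.
rewrite pdrop0 mulrC (stripE _ qE) //; congr (g _ * _).
by apply: qpath_eq; rewrite /parrows /= ?take0.
Qed.

Lemma strip_mono (a : arrow Q) k x w :
  strip a (mono k (x :: w)) = mono (k * (val a == x)%:R) w * vert (cw x).
Proof.
apply: funext => p; rewrite mulvertE.
have [ap|nap] := eqVneq (target a) (pstart p); last first.
  rewrite strip_eq0 //; case: ifP => // xp; rewrite /mono.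
  case: eqP => [ax|_]; last by rewrite mulr0 mul0r.
  by move: nap; rewrite targetE ax xp.
have [q qE] := path_cons ap.
rewrite (stripE _ qE) // /mono qE eqseq_cons.
case: eqP => [<-|_]; last by rewrite !mulr0 mul0r if_same.
by rewrite mulr1 -targetE ap eqxx.
Qed.

Lemma strip_mul_mono (a : arrow Q) f x :
  strip a (f * mono 1 [:: x]) = if val a == x then f * vert (cw x) else 0.
Proof.
apply: funext => p.
have [ap|nap] := eqVneq (target a) (pstart p); last first.
  rewrite strip_eq0 //; case: eqP => [ax|//]; rewrite mulvertE -ax -targetE.
  by rewrite (negPf nap).
have [q qE] := path_cons ap;
  rewrite (stripE _ qE) // mulmonoE qE /= prefix0s andbT eq_sym.
case: eqP => [ax|//]; rewrite mulr1 mulvertE -ax -targetE ap eqxx; congr (f _).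
apply: word_inj; first by rewrite word_pdrop qE /= drop0.
have aq : parrows q = a :: parrows p by apply: (inj_map val_inj).
transitivity (target a); last exact: ap.
by rewrite /pstart /= -/(parrows q) aq /= take0.
Qed.

Lemma stripD (a : arrow Q) f g : strip a (f + g) = strip a f + strip a g.
Proof.
apply: funext => p; rewrite cpaDE;
  have [ap|nap] := eqVneq (target a) (pstart p).
  by have [q qE] := path_cons ap; rewrite !(stripE _ qE).
by rewrite !strip_eq0 ?addr0.
Qed.

Lemma strip0 (a : arrow Q) : strip a 0 = 0.
Proof.
apply: funext => p; have [ap|nap] := eqVneq (target a) (pstart p).
  by have [q qE] := path_cons ap; rewrite (stripE _ qE).
by rewrite strip_eq0.
Qed.

Lemma strip_sum (a : arrow Q) I (r : seq I) (F : I -> cpa K Q) :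
  strip a (\sum_(i <- r) F i) = \sum_(i <- r) strip a (F i).
Proof. exact: (big_morph _ (@stripD a) (@strip0 a)). Qed.

End Words.

(** * Cyclic derivatives of the potential and admissible cuts *)

Section Potential.
Variables (K : fieldType) (tau : triangulation) (wt : {set side tau} -> K).
Implicit Types (x y z : side tau) (w : seq (side tau)).

Local Notation Q := (tri_quiver tau).
Local Notation cw := (@cw tau).
Local Notation opp := (@opp tau).
Local Notation turn := (@turn tau).
Local Notation S := (potential wt).
Implicit Types (p q : qpath Q).

Definition pot w : K :=
  \sum_(T in internal_triangles tau) (w == cycle_word cw T)%:R
  + \sum_(P in punctures tau) wt P * (w == cycle_word turn P)%:R.

Lemma orbit_cw x : orbit cw x = [:: x; cw x; cw (cw x)].
Proof.
have u : uniq [:: x; cw x; cw (cw x)].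
  rewrite /= !inE [x == cw x]eq_sym [x == cw (cw x)]eq_sym.
  by rewrite [cw x == cw (cw x)]eq_sym !(negPf (cw_neq _)) (negPf (cw2_neq _)).
have c : fcycle cw [:: x; cw x; cw (cw x)] by rewrite /= cw_cw_cw !eqxx.
rewrite /orbit (order_cycle c u) //= ?inE ?eqxx //.
Qed.

Lemma cycle_wordP (s : side tau -> side tau) (T : {set side tau}) : T != set0 ->
  exists2 y, y \in T & cycle_word s T = orbit s y.
Proof.
case/set0Pn=> z zT; rewrite /cycle_word; case: pickP => [y yT|/(_ z)].
  by exists y.
by rewrite zT.
Qed.

Section CycleSum.
Variables (s : side tau ->
  side tau) (A : {set {set side tau}}) (c : {set side tau} -> K).
Hypothesis s_inj : injective s.
Hypothesis A_orbits : forall T y, T \in A -> y \in T -> T = orbit_set s y.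

(** Serves both halves of the potential, with [s] equal to [cw] and to [turn]: a rotation of
    [x :: w] can only be the word of the orbit through [x]. *)
Lemma cycle_sum x w :
  \sum_(k < (size w).+1) \sum_(T in A) c T * (rot k.+1 (x ::
    w) == cycle_word s T)%:R
  = if orbit_set s x \in A
    then c (orbit_set s x) * (w == traject s (s x) (order s x).-1)%:R else 0.
Proof.
have xx : x \in orbit_set s x by rewrite inE connect0.
have not_in T : T \in A -> T != orbit_set s x ->
    forall k : nat, (rot k.+1 (x :: w) == cycle_word s T) = false.
  move=> TA Tx k; apply/eqP => e.
  have : x \in cycle_word s T by rewrite -e mem_rot mem_head.
  rewrite /cycle_word; case: pickP => [y yT|//]; rewrite -fconnect_orbit => yx.
  have xT : x \in T by rewrite (A_orbits TA yT) inE.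
  by rewrite (A_orbits TA xT) eqxx in Tx.
rewrite exchange_big /=; case: ifPn => xA; last first.
  rewrite big1 // => T TA; rewrite big1 // => k _; rewrite not_in ?mulr0 //.
  by apply: contraNneq xA => <-.
rewrite (bigD1 _ xA) /= [X in _ + X]big1 ?addr0; last first.
  by move=> T /andP[TA Tx]; rewrite big1 // => k _; rewrite not_in ?mulr0.
rewrite -mulr_sumr; congr (_ * _).
have : orbit_set s x != set0 by apply/set0Pn; exists x.
case/(cycle_wordP s) => y; rewrite inE => xy ->.
exact: count_rotations.
Qed.

Lemma cycle_word_sum T0 : T0 \in A -> T0 != set0 ->
  \sum_(T in A) c T * (cycle_word s T0 == cycle_word s T)%:R = c T0.
Proof.
move=> T0A T0n; rewrite (bigD1 _ T0A) /= eqxx mulr1 big1 ?addr0 // => T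
  /andP[TA TT0].
case: eqP => [e|]; last by rewrite mulr0.
have [y yT0 ey] := cycle_wordP s T0n.
have : y \in cycle_word s T by rewrite -e ey /orbit -orderSpred mem_head.
rewrite /cycle_word; case: pickP => [z zT|//]; rewrite -fconnect_orbit => zy.
have yT : y \in T by rewrite (A_orbits TA zT) inE.
by rewrite (A_orbits TA yT) (A_orbits T0A yT0) eqxx in TT0.
Qed.

End CycleSum.

Lemma internal_triangles_orbits T y :
  T \in internal_triangles tau -> y \in T -> T = orbit_set cw y.
Proof.
case/imsetP=> z _ -> yT; apply/setP => u;
  rewrite [RHS]inE fconnect_orbit orbit_cw.
move: yT; rewrite !inE -!orbA => /or3P[] /eqP->; rewrite ?cw_cw_cw //.
  by rewrite orbC -orbA.
by rewrite orbA orbC.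
Qed.

Lemma orbit_set_internal x : (orbit_set cw x \in internal_triangles tau) =
  internal x.
Proof.
have e z : orbit_set cw z = [set z; cw z; cw (cw z)].
  by apply/setP => u; rewrite inE fconnect_orbit orbit_cw !inE orbA.
apply/idP/idP => [/imsetP[z iz]|ix]; last by rewrite e; apply/imsetP; exists x.
move=> /setP/(_ x); rewrite !inE connect0 => /esym/orP[/orP[]|]/eqP ->;
  by rewrite ?internal_cw.
Qed.

Lemma punctures_orbits P y :
  P \in punctures tau -> y \in P -> at_puncture y /\ P = orbit_set turn y.
Proof.
move=> Pp; move: (Pp); rewrite inE => /andP[/imsetP[z _ eP] _] yP.
have pz : at_puncture z by rewrite /at_puncture -eP.
move: yP; rewrite eP marked_point_puncture // inE => zy.
rewrite -(at_puncture_connect zy) pz; split=> //; apply/setP => u.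
by rewrite !inE (same_connect (fconnect_sym (@turn_inj tau)) zy).
Qed.

Lemma orbit_set_puncture x : (orbit_set turn x \in punctures tau) =
  at_puncture x.
Proof.
apply/idP/idP => [xp|xp].
  by have [] := @punctures_orbits _ x xp; rewrite ?inE ?connect0.
by rewrite /orbit_set -marked_point_puncture.
Qed.

Definition dpot x : cpa K Q :=
  mono (internal x)%:R [:: cw x; cw (cw x)]
  + (if at_puncture x
     then mono (wt (marked_point x)) (traject turn (turn x) (order turn x).-1)
     else 0).

Lemma coef_pot v (s : seq (arrow Q)) :
  walk v s -> coef S v s = pot (map val s).
Proof.
move=> vs; rewrite /coef; case: insubP => [u _ uE|/negP//].
by rewrite [S u]/(pot (word u)) /word /parrows uE.
Qed.

Hypothesis val3 : valency_ge3 tau.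

Lemma cyclic_derivativeE (a : arrow Q) : cyclic_derivative a S = dpot (val a).
Proof.
apply: funext => p; rewrite /cyclic_derivative.
pose F : K := (if internal (val a) then 1 * (word p == [:: cw (val a);
  cw (cw (val a))])%:R else 0)
  + (if at_puncture (val a) then wt (marked_point (val a)) *
   (word p == traject turn (turn (val a)) (order turn (val a)).-1)%:R else 0).
have -> : dpot (val a) p = F.
  rewrite /dpot cpaDE /F /mono; congr (_ + _).
    by case: internal; rewrite ?mul0r.
  by case: ifP.
case: ifPn => [/andP[/eqP sp /eqP ep]|guard].
  rewrite -size_word.
  transitivity (\sum_(k < (size (word p)).+1) pot (rot k.+1 (val a :: word p))).
    apply: eq_bigr => k _.
    rewrite coef_pot; last first.
      rewrite walk_cat; apply/andP; split; first exact: (valP (pdrop k p)).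
      have e : endpoint (pstart (pdrop k p)) (parrows (pdrop k p)) = source a.
        by rewrite -ep /pend /pstart /parrows -endpoint_cat cat_take_drop.
      rewrite e; apply/andP; split; first exact: eqxx.
      by rewrite -sp; exact: (valP (ptake k p)).
    by congr pot; rewrite map_cat /= -!/(word _) word_pdrop word_ptake.
  rewrite big_split /=; congr (_ + _).
    under eq_bigr do under eq_bigr do rewrite -[_%:R]mul1r.
    rewrite (cycle_sum (fun=> 1) (@cw_inj tau)); last exact:
      internal_triangles_orbits.
    by rewrite orbit_set_internal /order_set -size_orbit orbit_cw.
  rewrite (cycle_sum wt (@turn_inj tau)); last by move=>
    T y TA /(punctures_orbits TA)[].
  rewrite orbit_set_puncture; case: ifP => // pa.
  by rewrite /orbit_set -marked_point_puncture.
(* A path not running from the target to the source of [a] has neither of the two words, as each of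
   them forces these endpoints. *)
apply/esym; rewrite /F; move: guard; rewrite negb_and => guard.
rewrite [X in X + _](_ : _ = 0) ?add0r; last first.
  case: ifP => // _; case: eqP => [e|]; last by rewrite mulr0.
  case/orP: guard => /eqP[].
    apply/esym/eqP; rewrite targetE.
    by case: (word_cons e).
  apply/esym/eqP; rewrite sourceE -[val a]cw_cw_cw.
  by apply: pend_word (_ : word p = rcons [:: cw (val a)] _).
case: ifP => // pa; have := order_puncture val3 pa.
case oE : (order turn (val a)) => [|[|n]] // _.
case: eqP => [e|]; last by rewrite mulr0.
case/orP: guard => /eqP[].
  apply/esym/eqP; rewrite targetE -opp_turn.
  by case: (word_cons e) => /arcP[_ ->] _; rewrite !inE eqxx orbT.
apply/esym/eqP; rewrite sourceE.
have := iter_turn pa oE; rewrite iterS => aE.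
have : cw (iter n.+1 turn (val a)) \in val (pend p).
  by apply: (@pend_word _ _ _ (traject turn (turn (val a)) n));
    rewrite e [LHS]trajectSr -iterSr.
by move=> /arcP[_ ->]; rewrite !inE -[X in X == opp _]aE eqxx orbT.
Qed.

End Potential.

(** * Cut corners of triangles and punctures *)

Section Syzygies.
Variables (K : fieldType) (tau : triangulation) (wt : {set side tau} -> K).
Implicit Types (x y z : side tau) (w : seq (side tau)).

Local Notation Q := (tri_quiver tau).
Local Notation cw := (@cw tau).
Local Notation opp := (@opp tau).
Local Notation turn := (@turn tau).
Local Notation S := (potential wt).
Implicit Types (p q : qpath Q) (f g : cpa K Q).

Hypothesis val3 : valency_ge3 tau.
Hypothesis wt_neq0 : forall P, P \in punctures tau -> wt P != 0.
Variable d : arrow Q -> bool.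
Hypothesis d_cut : admissible_cut S d.

Local Notation Lam := (degree_zero_subalgebra S d).
Local Notation mk := (@mk K Q S d).
Local Notation deg0 := (@deg0 K Q d).

Definition cut x : bool :=
  if insub x is Some a then d (a : tri_arrow tau) else false.

Definition uncut x : bool := is_arrow x && ~~ cut x.

Lemma cutE (a : arrow Q) : cut (val a) = d a.
Proof. by rewrite /cut valK. Qed.

Lemma degree_oneP x : degree_one d x <-> cut x.
Proof.
split=> [[a <-]|]; first by rewrite cutE.
by rewrite /cut; case: insubP => // a _ <- da; exists a.
Qed.

Lemma cut_is_arrow x : cut x -> is_arrow x.
Proof. by rewrite /cut; case: insubP. Qed.

Lemma degree_word p : degree d p = count cut (word p).
Proof.
rewrite /degree -sum1_count /word big_map [RHS]big_mkcond /=.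
by apply: eq_bigr => a _; rewrite cutE; case: d.
Qed.

Lemma degree_eq0 p : (degree d p == 0%N) = all uncut (word p).
Proof.
rewrite degree_word -leqn0 leqNgt -has_count -all_predC.
have := word_is_arrow p; elim: (word p) => //= x w IH /andP[ax /IH->].
by rewrite /uncut ax.
Qed.

(** The cycle of a puncture cannot cancel against a 3-cycle of a triangle: if the words agreed,
    [turn] and [cw] would agree at a corner, and an arc there would be a boundary segment. Hence
    this cycle does appear in the potential and has degree 1. *)
Lemma pot_turn_word x : at_puncture x ->
  pot wt (cycle_word turn (orbit_set turn x)) = wt (orbit_set turn x).
Proof.
move=> px; have xP : orbit_set turn x \in punctures tau by rewrite
  orbit_set_puncture.
have orb T y : T \in punctures tau -> y \in T -> T = orbit_set turn y.
  by move=> TA /(punctures_orbits TA)[].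
have ne : orbit_set turn x != set0 by apply/set0Pn; exists x;
  rewrite inE connect0.
rewrite /pot (cycle_word_sum _ orb) // big1 ?add0r // => T TA.
have [y yT ->] := cycle_wordP turn ne.
case: eqP => // e; exfalso; move: e; rewrite /cycle_word.
case: pickP => [z zT|_]; last by rewrite /orbit -orderSpred.
have [py _] := punctures_orbits xP yT.
have := order_puncture val3 py; rewrite orbit_cw /orbit.
case: (order turn y) => [|[|n]] //= _ [yz e _].
by have [_ /negP[]] := at_puncture_inner py;
  rewrite -[X in X == _]/(turn y) e yz.
Qed.

Lemma pot_cw_word x : internal x ->
  pot wt (cycle_word cw (orbit_set cw x)) = 1.
Proof.
move=> ix; have xP : orbit_set cw x \in internal_triangles tau by rewrite
  orbit_set_internal.
have ne : orbit_set cw x != set0 by apply/set0Pn; exists x;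
  rewrite inE connect0.
rewrite /pot; under eq_bigr do rewrite -[_%:R]mul1r.
rewrite (cycle_word_sum (fun=> 1) (@internal_triangles_orbits tau)) //.
rewrite big1 ?addr0 // => T TA.
have [y yT ->] := cycle_wordP cw ne.
case: eqP => [e|]; last by rewrite mulr0.
exfalso; move: e; rewrite /cycle_word.
case: pickP => [z zT|_]; last by rewrite /orbit -orderSpred.
have [pz _] := punctures_orbits TA zT.
have := order_puncture val3 pz; rewrite orbit_cw /orbit.
case: (order turn z) => [|[|n]] //= _ [yz e _].
by have [_ /negP[]] := at_puncture_inner pz;
  rewrite -[X in X == _]/(turn z) -e yz.
Qed.

Lemma cut_count w : all (@is_arrow tau) w -> (if w is x ::
  w' then path (@step tau) x w' else false) ->
  pot wt w != 0 -> count cut w = 1%N.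
Proof.
case: w => // x w ar st; have [p <-] := path_of_word ar st => Sp.
by rewrite -degree_word; apply: d_cut.1.
Qed.

Lemma cut_internal x : internal x ->
  (cut x + cut (cw x) + cut (cw (cw x)))%N = 1%N.
Proof.
move=> ix; have xP : orbit_set cw x \in internal_triangles tau by rewrite
  orbit_set_internal.
have ne : orbit_set cw x != set0 by apply/set0Pn; exists x;
  rewrite inE connect0.
have [y yT e] := cycle_wordP cw ne.
have iy : internal y.
  by rewrite -orbit_set_internal -(internal_triangles_orbits xP yT).
have : count cut (orbit cw y) = 1%N.
  apply: cut_count; rewrite ?orbit_cw.
  - rewrite /= /is_arrow cw_cw_cw; case/and3P: iy => -> -> ->; done.
  - by rewrite /= /step !eqxx.
  - by rewrite -orbit_cw -e pot_cw_word ?oner_eq0.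
move: yT; rewrite inE fconnect_orbit orbit_cw !inE orbit_cw /= addn0.
by case/or3P=> /eqP ->; rewrite ?cw_cw_cw; lia.
Qed.

Lemma cut_puncture x : at_puncture x -> count cut (orbit turn x) = 1%N.
Proof.
move=> px; have xP : orbit_set turn x \in punctures tau by rewrite
  orbit_set_puncture.
have ne : orbit_set turn x != set0 by apply/set0Pn; exists x;
  rewrite inE connect0.
have orb T y : T \in punctures tau -> y \in T -> T = orbit_set turn y.
  by move=> TA /(punctures_orbits TA)[].
have [y yT e] := cycle_wordP turn ne.
have [py oxy] := punctures_orbits xP yT.
have <- : count cut (orbit turn y) = 1%N.
  apply: cut_count.
  - apply/allP => z; rewrite -fconnect_orbit => yz.
    by move/at_punctureP: py; apply.
  - rewrite /orbit -orderSpred trajectS.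
    have /(sub_path (e' := @step tau)) : fpath turn y (traject turn (turn y)
      (order turn y).-1).
      exact: fpath_traject.
    by apply=> u v /= /eqP <-; rewrite /step eqxx orbT.
  - by rewrite -e pot_turn_word // wt_neq0.
apply/permP; apply: uniq_perm; rewrite ?orbit_uniq // => z.
move/setP/(_ z): oxy; rewrite !inE => oxy.
by rewrite -!fconnect_orbit oxy.
Qed.

Lemma cut_in_potential x : cut x -> internal x || at_puncture x.
Proof.
rewrite /cut; case: insubP => // a _ <-; apply: contraTT;
  rewrite negb_or => /andP[ni np].
rewrite d_cut.2 // => p; apply: contraNN => /(map_f val);
  rewrite -/(word p) => ap.
apply/eqP; rewrite -[S p]/(pot wt (word p)) /pot !big1 ?addr0 // => T TA; case:
  eqP => [e|];
  rewrite ?mulr0 //; exfalso; move: ap; rewrite e /cycle_word; case: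
    pickP => // y yT;
  rewrite -fconnect_orbit => ya.
- case/negP: np; have [py _] := punctures_orbits TA yT.
  by rewrite -(at_puncture_connect ya).
- case/negP: ni; rewrite -orbit_set_internal.
  have aT : val a \in T by rewrite (internal_triangles_orbits TA yT) inE.
  by rewrite -(internal_triangles_orbits TA aT).
Qed.

Lemma uncut_is_arrow x : uncut x -> is_arrow x. Proof. by case/andP. Qed.

Lemma uncut_internal x : uncut x -> uncut (cw x) -> internal x.
Proof.
move=> /uncut_is_arrow/andP[ix icx] /uncut_is_arrow/andP[_ iccx].
by rewrite /internal ix icx iccx.
Qed.

Lemma uncut_not_cut x : uncut x -> cut x = false. Proof. by case/andP=>
  _ /negPf. Qed.

Lemma internal_uncut x : internal x -> uncut x = ~~ cut x.
Proof. by move=> /and3P[ix icx _]; rewrite /uncut /is_arrow ix icx. Qed.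

Lemma at_puncture_uncut x : at_puncture x -> uncut x = ~~ cut x.
Proof. by case/at_puncture_inner=> ix icx; rewrite /uncut /is_arrow ix icx. Qed.

Lemma internal_cut x : internal x -> cut (cw (cw x)) = uncut x && uncut (cw x).
Proof.
move=> ix; rewrite !internal_uncut ?internal_cw //; move: (cut_internal ix).
by case: cut; case: cut; case: cut.
Qed.

Lemma cut_at_puncture_unique x y :
  at_puncture x -> cut x -> cut y -> fconnect turn x y -> x = y.
Proof.
move=> px cx cy; rewrite fconnect_orbit orbit_cons inE => /predU1P[//|xy].
have := cut_puncture px; rewrite orbit_cons /= cx add1n => -[] /eqP.
by rewrite -leqn0 leqNgt -has_count => /hasPn/(_ y xy); rewrite cy.
Qed.

Lemma puncture_run_uncut x : at_puncture x -> cut x ->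
  all uncut (traject turn (turn x) (order turn x).-1).
Proof.
move=> px cx; have := cut_puncture px;
  rewrite orbit_cons /= cx add1n => -[] /eqP.
rewrite -leqn0 leqNgt -has_count => /hasPn cut0; apply/allP => y xy.
rewrite at_puncture_uncut ?cut0 // -(@at_puncture_connect _ x) //.
by rewrite fconnect_orbit orbit_cons inE xy orbT.
Qed.

Lemma puncture_cut_corner x : at_puncture x ->
  exists2 y, cut y & fconnect turn y x.
Proof.
move=> px; have : has cut (orbit turn x) by rewrite has_count cut_puncture.
case/hasP=> y; rewrite -fconnect_orbit => xy cy; exists y => //.
by rewrite fconnect_sym //; apply: turn_inj.
Qed.

(** A run through the whole orbit would consist of arrows only, so the marked point would be a
    puncture, and its cycle contains a cut arrow. *)
Lemma uncut_run_bound x n : all uncut (traject turn x n) ->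
  (n < order turn x)%N.
Proof.
move=> /allP un; rewrite ltnNge; apply/negP => le.
have uo y : fconnect turn x y -> uncut y.
  rewrite fconnect_orbit => /trajectP[k kx ->]; apply: un.
  by apply/trajectP; exists k => //; apply: leq_trans le.
have px : at_puncture x by apply/at_punctureP => y /uo/uncut_is_arrow.
have [y cy yx] := puncture_cut_corner px.
have := uo y; rewrite fconnect_sym; last exact: turn_inj.
by move=> /(_ yx)/uncut_not_cut; rewrite cy.
Qed.

(** * Relations between words *)

Lemma dpot_neq0 x p : dpot wt x p != 0 ->
  (internal x /\ word p = [:: cw x; cw (cw x)]) \/
  (at_puncture x /\ word p = traject turn (turn x) (order turn x).-1).
Proof.
rewrite /dpot cpaDE /mono.
have [/andP[ix /eqP e]|n1] := boolP (internal x &&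
  (word p == [:: cw x; cw (cw x)])).
  by left.
rewrite (_ : _%:R * _ = 0) ?add0r; last first.
  by move: n1; case: internal => [/= /negPf ->|]; rewrite ?mulr0 ?mul0r.
case: ifP => // px; last by rewrite eqxx.
by rewrite /=; case: (word p =P _) => [e _|_]; [right | rewrite mulr0 eqxx].
Qed.

Lemma dpot_degree (a : arrow Q) p :
  dpot wt (val a) p != 0 -> (degree d p + d a)%N = 1%N.
Proof.
rewrite degree_word -cutE => /dpot_neq0[[ia ->]|[pa ->]].
  by have := cut_internal ia; rewrite /=; lia.
by have := cut_puncture pa; rewrite orbit_cons /=; lia.
Qed.

(** The derivative at [a] is homogeneous of degree [1 - d a], so only the cut arrows give relations
    in Lambda. *)
Lemma deg0_derivative (a : arrow Q) :
  deg0 (cyclic_derivative a S) = if d a then cyclic_derivative a S else 0.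
Proof.
rewrite cyclic_derivativeE //; apply: funext => p; rewrite /deg0.
have [e|/dpot_degree] := eqVneq (dpot wt (val a) p) 0.
  by rewrite e if_same; case: (d a).
by case: (d a); case: eqP => //= dp ddp; exfalso; lia.
Qed.

Lemma derivative_ideal_deg0 f : derivative_ideal S f ->
  derivative_ideal S (deg0 f).
Proof.
case=> s ->; exists [seq (deg0 t.1.1, t.1.2, deg0 t.2) | t <- s & d t.1.2].
rewrite big_map big_filter [RHS]big_mkcond /=.
elim/big_rec2: _ => [|t g h _ <-]; first by rewrite deg0_0.
by rewrite deg0D !deg0M deg0_derivative; case: d; rewrite ?mulr0 ?mul0r ?add0r.
Qed.

Lemma jacobian_ideal_deg0 f : jacobian_ideal S f -> jacobian_ideal S (deg0 f).
Proof.
move=> Jf n; have [g Ig fg] := Jf n; exists (deg0 g); first exact: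
  derivative_ideal_deg0.
by move=> p pn; rewrite /deg0 fg.
Qed.

Lemma mk_jacobian f : jacobian_ideal S f -> mk f = 0.
Proof. by move=> Jf; apply/mk_eq0/jacobian_ideal_deg0. Qed.

Lemma mk_dpot x : is_arrow x -> mk (dpot wt x) = 0.
Proof.
move=> ax; pose a : arrow Q := exist _ x ax.
rewrite -[x]/(val a) -cyclic_derivativeE //;
  apply/mk_jacobian/derivative_in_jacobian.
by exists [:: (1, a, 1)]; rewrite big_seq1 mul1r mulr1.
Qed.

Definition mk_word (k : K) w := mk (mono k w).
Local Notation V := mk_word.

Lemma mk_wordM k k' w w' : V k w * V k' w' = V (k * k') (w' ++ w).
Proof. by rewrite /mk_word -mkM mono_mul. Qed.

Lemma mk_word0 w : V 0 w = 0.
Proof. by rewrite /mk_word mono0 mk0. Qed.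

Lemma mk_wordN k w : V (- k) w = - V k w.
Proof. by rewrite /mk_word monoN mkN. Qed.

Lemma mk_word_nil : V 1 [::] = 1.
Proof. by rewrite /mk_word mono1 mk1. Qed.

Lemma mk_word_eq0 k w : V 1 w = 0 -> V k w = 0.
Proof. by move=> w0; rewrite -[k]mulr1 -[w]cats0 -mk_wordM w0 mulr0. Qed.

Lemma mk_word_eq0E k w : k != 0 -> V k w = 0 -> V 1 w = 0.
Proof. by move=> k0 w0; rewrite -(mulVf k0) -[w]cats0 -mk_wordM w0 mulr0. Qed.

Lemma mk_word_infix k w1 w w2 : V 1 w = 0 -> V k (w1 ++ w ++ w2) = 0.
Proof.
move=> w0; apply: mk_word_eq0.
by rewrite -[1]mulr1 -mk_wordM -[1]mulr1 -mk_wordM w0 mulr0 mul0r.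
Qed.

Lemma mk_word_cut k w : ~~ all uncut w -> V k w = 0.
Proof.
move=> cw; apply/mk_eq0; rewrite (_ : deg0 _ = 0); first exact: jacobian_ideal0.
apply: funext => p; rewrite /deg0 degree_eq0 /mono.
by case: ifP => // pu; case: eqP => [e|]; rewrite ?mulr0 //;
  rewrite -e pu in cw.
Qed.

Lemma mk_word_step k x w : ~~ path (@step tau) x w -> V k (x :: w) = 0.
Proof.
move=> nst; rewrite /mk_word (_ : mono _ _ = 0) ?mk0 //.
apply: funext => p; rewrite /mono; case: eqP => [e|]; rewrite ?mulr0 //.
by case: (word_cons e) => _; rewrite (negPf nst).
Qed.

(** The rewriting rule. Two uncut arrows of a triangle make its third arrow cut; the relation of
    that arrow equates them, up to a scalar, with the rest of the cycle at the third corner, or with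
    0 if there is no puncture. *)
Lemma mk_word_cw y : V 1 [:: y; cw y] = 0 \/
  [/\ uncut y, uncut (cw y), cut (cw (cw y)), at_puncture (cw (cw y)) &
   forall k, V k [:: y; cw y] =
     V (- (k * wt (marked_point (cw (cw y)))))
       (traject turn (opp y) (order turn (cw (cw y))).-1)].
Proof.
have [/andP[uy ucy]|nu] := boolP (uncut y && uncut (cw y)); last first.
  by left; apply: mk_word_cut; rewrite /= andbT.
have iy : internal y by apply: uncut_internal.
have cccy : cut (cw (cw y)) by rewrite internal_cut // uy ucy.
have := mk_dpot (cut_is_arrow cccy).
rewrite /dpot !internal_cw iy !cw_cw_cw turn_cw2 mkD -/(V _ _).
case: ifP => [py rel|_]; last by rewrite mk0 addr0; left.
right; split=> // k; rewrite -[k]mulr1 -[[:: _; _]]cats0 -mk_wordM.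
move/eqP: rel; rewrite addr_eq0 => /eqP ->.
by rewrite -mulrN -!/(V _ _) -mk_wordN mk_wordM cats0 !mulr1.
Qed.

Definition in_radical_power n (u : Lam) := exists2 f, order_ge n f & u = mk f.
Local Notation Rad := in_radical_power.

Lemma radical_power0 u : Rad 0 u.
Proof. by have [f ->] := mk_surj u; exists f. Qed.

Lemma radical_power_zero n : Rad n 0.
Proof. by exists 0; rewrite ?mk0. Qed.

Lemma radical_powerD n u v : Rad n u -> Rad n v -> Rad n (u + v).
Proof.
move=> [f fn ->] [g gn ->]; exists (f + g); last by rewrite mkD.
by move=> p pn; rewrite cpaDE fn ?gn ?addr0.
Qed.

Lemma radical_powerM n m u v : Rad n u -> Rad m v -> Rad (n + m) (u * v).
Proof.
move=> [f fn ->] [g gm ->]; exists (f * g); last by rewrite mkM.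
move=> p pnm; rewrite cpaME big1 // => k _;
  have kp : (k <= plen p)%N by rewrite -ltnS.
have [km|mk] := ltnP k m; first by rewrite gm ?mulr0 // plen_ptake.
by rewrite fn ?mul0r // plen_pdrop ltn_subLR // (leq_trans pnm) // addnC
  leq_add2r.
Qed.

Lemma radical_powerW n m u : (n <= m)%N -> Rad m u -> Rad n u.
Proof. by move=> nm [f fm ->]; exists f => // p pn;
  apply/fm/(leq_trans pn). Qed.

Lemma radical_power_word k w : Rad (size w) (V k w).
Proof.
exists (mono k w) => // p; rewrite /mono -size_word; case: eqP => [->|_ _].
  by rewrite ltnn.
by rewrite mulr0.
Qed.

Lemma radical_power_eq0 u : (forall n, Rad n u) -> u = 0.
Proof.
have [f ->] := mk_surj u => H; apply: mk_closed => n.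
by have [g gn fg] := H n; exists g.
Qed.

(* Replacing [y; cw y] by a path around a puncture and then the last two arrows
   by a path around another puncture gives again a path of this shape. *)
Lemma cw_turn_rewrite y : V 1 [:: y; cw y; turn (cw y)] = 0 \/
  exists k w1 z w2,
    V 1 [:: y; cw y; turn (cw y)] =
      V k (w1 ++ [:: z; cw z; turn (cw z)] ++ w2) /\
    (size w1 + size w2 = 0 ->
     [/\ z = opp y, at_puncture (cw (cw y)) /\ order turn (cw (cw y)) = 3 &
         at_puncture (cw (opp y)) /\ order turn (cw (opp y)) = 3])%N.
Proof.
have split w : V 1 (w ++ [:: turn (cw y)]) = V 1 [:: turn (cw y)] * V 1 w.
  by rewrite mk_wordM mulr1.
rewrite -[[:: _, _ & _]]/([:: y; cw y] ++ [:: turn (cw y)]).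
have [e|[_ _ _ py e]] := mk_word_cw y.
  by left; rewrite split e mulr0.
have := order_puncture val3 py; case oy: (order _ _) => [|[|[|n]]] // _.
move: (e 1) => {}e; rewrite oy -[n.+3.-1]/n.+2 in e.
(* [u1] and [u2] are the last arrows of the substituted run. The arrow after it is [cw u2], so the
   rule applies again at [u2]. *)
pose u1 := iter n turn (opp y); pose u2 := turn u1.
have tE : traject turn (opp y) n.+2 = traject turn (opp y) n ++ [:: u1; u2].
  by rewrite -addn2 trajectD.
have u2E : turn (cw y) = cw u2.
  have tu : turn u2 = cw (cw y) by have := iter_turn py oy;
    rewrite iterSr turn_cw2.
  by rewrite -[turn (cw y)]/(opp (cw (cw y))) -tu opp_turn.
rewrite split e tE u2E mk_wordM mul1r -catA /=.
set k := - _.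
have u1E : opp u2 = cw u1 by rewrite /u2 opp_turn.
have [e'|[_ _ _ pu e']] := mk_word_cw u2.
  by left; rewrite -cat1s catA -[_ ++ [:: u2; _]]cats0 -catA mk_word_infix.
have pu' : at_puncture (cw u1) by rewrite -u1E -turn_cw2 at_puncture_turn.
have ou' : order turn (cw (cw u2)) = order turn (cw u1).
  by rewrite -u1E -turn_cw2 order_step //; apply: turn_inj.
have := order_puncture val3 pu'; case ou: (order _ _) => [|[|[|n']]] // _.
right; pose k' := - (1 * wt (marked_point (cw (cw u2)))).
exists (k * k'), (traject turn (opp y) n), u1,
  (traject turn (turn (turn (cw u1))) n').
split.
  transitivity (V 1 [:: u2; cw u2] * V k (traject turn (opp y) n ++ [:: u1])).
    by rewrite mk_wordM mul1r -catA.
  by rewrite e' ou' ou u1E mk_wordM mulrC -catA.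
rewrite !size_traject => /eqP; rewrite addn_eq0 => /andP[/eqP n0 /eqP n'0].
have u1y : u1 = opp y by rewrite /u1 n0.
by rewrite -u1y; split=> //; split=> //; [rewrite n0 | rewrite ou n'0].
Qed.

Hypothesis boundary : has_boundary tau.

(** By induction the class lies in every radical power. A rewriting that adds letters gains a power
    by the induction hypothesis. One that keeps length 3 passes from [y] to [opp y] and needs two
    punctures of valency 3; a second such step yields a third puncture, hence the tetrahedron. *)
Lemma mk_word_cw_turn y : V 1 [:: y; cw y; turn (cw y)] = 0.
Proof.
apply: radical_power_eq0 => n; elim: n y => [|n IH] y; first exact:
  radical_power0.
have pad k w1 z w2 : (0 < size w1 + size w2)%N ->
    Rad n.+1 (V k (w1 ++ [:: z; cw z; turn (cw z)] ++ w2)).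
  move=> pos; have -> : V k (w1 ++ [:: z; cw z; turn (cw z)] ++ w2) =
      V 1 w2 * V 1 [:: z; cw z; turn (cw z)] * V k w1.
    by rewrite !mk_wordM !mul1r catA.
  have := radical_powerM (radical_powerM (radical_power_word 1 w2) (IH z))
    (radical_power_word k w1).
  by apply: radical_powerW; lia.
have [->|[k [w1 [z [w2 [-> H]]]]]] := cw_turn_rewrite y; first exact:
  radical_power_zero.
have [s0|pos] := posnP (size w1 + size w2); last exact: pad.
have [zE [py oy] [po oo]] := H s0.
have [w10 w20] : w1 = [::] /\ w2 = [::].
  by move/eqP: s0; rewrite addn_eq0 !size_eq0 => /andP[/eqP -> /eqP ->].
rewrite w10 w20 {}zE /=.
have -> : V k [:: opp y; cw (opp y); turn (cw (opp y))] =
    V 1 [:: opp y; cw (opp y); turn (cw (opp y))] * V k [::].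
  by rewrite mk_wordM mul1r.
have [->|[k' [w1' [z' [w2' [-> H']]]]]] := cw_turn_rewrite (opp y).
  by rewrite mul0r; exact: radical_power_zero.
have [s0'|pos] := posnP (size w1' + size w2'); last first.
  by rewrite -[n.+1]addn0; apply:
    radical_powerM (pad _ _ _ _ pos) (radical_power0 _).
have [_ [pz oz] _] := H' s0'.
by have := three_punctures_of_valency3 py oy pz oz po oo.
Qed.

(** Rewriting the last two arrows puts [cw y] and [turn (cw y)] directly after [y], which gives a
    word already known to vanish. *)
Lemma mk_word_turn_cw y : V 1 [:: y; turn y; cw (turn y)] = 0.
Proof.
rewrite -[[:: _, _ & _]]/([:: y] ++ [:: turn y; cw (turn y)]).
have [e|[_ _ _ py e]] := mk_word_cw (turn y).
  by rewrite -[[:: turn y; _]]cats0 mk_word_infix.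
have := order_puncture val3 py; case oy: (order _ _) => [|[|[|n]]] // _.
rewrite -[1]mulr1 -mk_wordM e oy mk_wordM opp_turn.
rewrite -[traject _ _ _]/([:: cw y;
  turn (cw y)] ++ traject turn (turn (turn (cw y))) n).
by rewrite catA -[_ ++ traject _ _ _]cat0s mk_word_infix // mk_word_cw_turn.
Qed.

Lemma not_fpath_split x w : ~~ fpath turn x w ->
  exists w1 a b w2, x :: w = w1 ++ [:: a; b] ++ w2 /\ turn a != b.
Proof.
elim: w x => //= y w IH x;
  rewrite negb_and => /orP[ne|/IH[w1 [a [b [w2 [-> ne]]]]]].
  by exists [::], x, y, w.
by exists (x :: w1), a, b, w2.
Qed.

(** Where the path leaves its marked point it uses two arrows of a triangle. Having at least three
    arrows, it contains a neighbour of this pair, and each kind of triple vanishes; three arrows of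
    one triangle include a cut one. *)
Lemma mk_word_not_turn k x w : (1 < size w)%N -> ~~ fpath turn x w -> V k (x ::
  w) = 0.
Proof.
move=> sw /not_fpath_split[w1 [a [b [w2 [e ne]]]]]; apply: mk_word_eq0.
have {}sw : (2 < size w1 + (2 + size w2))%N.
  by have := congr1 size e; rewrite !size_cat /= => <-.
rewrite e; have [bE|nb] := eqVneq b (cw a); last first.
  rewrite mk_word_infix // mk_word_step //= /step (negPf nb) eq_sym (negPf ne)
    //.
rewrite bE; case/lastP: w1 sw {e} => [|w1 z] sw.
  case: w2 sw => // c w2 _.
  rewrite -[_ ++ _]/([::] ++ [:: a; cw a; c] ++ w2) mk_word_infix //.
  have [->|nc] := eqVneq c (turn (cw a)); first exact: mk_word_cw_turn.
  have [->|nc'] := eqVneq c (cw (cw a)); last first.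
    by rewrite mk_word_step //= /step (negPf nc) (negPf nc') andbF.
  apply: mk_word_cut; rewrite /= andbT; apply/negP => /and3P[ua uca ucca].
  have ia : internal a by apply: uncut_internal.
  by move: (internal_cut ia); rewrite ua uca (uncut_not_cut ucca).
rewrite -cats1 -catA catA -[_ ++ [:: z]]/(w1 ++ [:: z]) -catA.
rewrite -[[:: z] ++ _]/([:: z; a; cw a] ++ w2) mk_word_infix //.
have [->|na] := eqVneq a (turn z); first exact: mk_word_turn_cw.
have [->|na'] := eqVneq a (cw z); last first.
  by rewrite mk_word_step //= /step (negPf na) (negPf na').
apply: mk_word_cut; rewrite /= andbT; apply/negP => /and3P[ua uca ucca].
have ia : internal z by apply: uncut_internal.
by move: (internal_cut ia); rewrite ua uca (uncut_not_cut ucca).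
Qed.

(** A turning word with as many letters as there are sides meets a cut arrow; the added 3 brings
    other words into the range of [mk_word_not_turn]. *)
Definition word_bound := #|side tau|.+3.

Lemma mk_word_bound k w : (word_bound <= size w)%N -> V k w = 0.
Proof.
case: w => // x w sw; have [fw|nfw] := boolP (fpath turn x w); last first.
  by apply: mk_word_not_turn => //; move: sw; rewrite /word_bound /=; lia.
apply: mk_word_cut; apply/negP;
  rewrite (fpathE fw) -[_ :: _]/(traject turn x (size w).+1).
move/uncut_run_bound => lt.
have := leq_trans lt (max_card _); move: sw; rewrite /word_bound /=; lia.
Qed.

Lemma mk_strip f : mk f = mk (trivial_part f) +
  \sum_(a : arrow Q) mk (strip a f) * V 1 [:: val a].
Proof.
rewrite {1}[f]strip_decomposition mkD mk_sum; congr (_ + _).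
by apply: eq_bigr => a _; rewrite mkM.
Qed.

(** The support of [f] may be infinite, so its finitely many possible first arrows are split off
    repeatedly into [w], until [w] reaches [word_bound] and vanishes. *)
Lemma mk_eq0_words f : (forall p, f p != 0 -> V 1 (word p) = 0) -> mk f = 0.
Proof.
suff H n w : (word_bound <= size w + n)%N ->
    (forall p, f p != 0 -> V 1 (w ++ word p) = 0) -> mk f * V 1 w = 0.
  move=> f0; rewrite -[mk f]mulr1 -mk_word_nil.
  exact: (H word_bound).
elim: n f w => [|n IH] f w wn f0;
  first by rewrite mk_word_bound ?mulr0 // -[size w]addn0.
rewrite mk_strip mulrDl mulr_suml big1 ?addr0 => [|a _]; last first.
  rewrite -mulrA mk_wordM mulr1; apply: IH;
    first by rewrite size_cat addn1 addSnnS.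
  move=> p sp; have [ap|nap] := eqVneq (target a) (pstart p); last first.
    by rewrite strip_eq0 ?eqxx in sp.
  have [q qw] := path_cons ap.
  by rewrite -catA -[[:: val a] ++ _]/(val a ::
    word p) -qw f0 // -(stripE f qw ap).
(* The constant part of [f] either is 0 or, by the hypothesis at a trivial path, forces [w] itself
   to vanish in Lambda. *)
have [[p p0 fp]|nf] := pselect (exists2 p, plen p = 0%N & f p != 0).
  move: (f0 p fp); have /size0nil -> : size (word p) = 0%N by rewrite size_word.
  by rewrite cats0 => ->; rewrite mulr0.
rewrite (_ : trivial_part f = 0) ?mk0 ?mul0r //; apply: funext => p.
rewrite /trivial_part; case: eqP => // p0; apply/eqP; apply:
  contra_notT nf => fp.
by exists p.
Qed.

(** * Coefficients of elements of the Jacobian ideal *)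

Lemma sandwich (A X B : cpa K Q) p :
    (forall q, infix (word q) (word p) -> (plen q < plen p)%N -> X q = 0) ->
  (A * X * B) p = A (ptriv (pend p)) * X p * B (ptriv (pstart p)).
Proof.
move=> X0; have mid j k : (k <= plen p)%N -> (j + k < plen p)%N || (0 < k)%N ->
      (j <= plen p - k)%N ->
    X (ptake j (pdrop k p)) = 0.
  move=> kp jk jpk; apply: X0; last by rewrite plen_ptake ?plen_pdrop //; lia.
  rewrite word_ptake word_pdrop; apply/infixP.
  exists (take k (word p)), (drop j (drop k (word p))).
  by rewrite [take j _ ++ _]cat_take_drop cat_take_drop.
rewrite cpaME (bigD1 ord0) //= [X in _ + X]big1 ?addr0; last first.
  move=> k k0; rewrite cpaME big1 ?mul0r // => j _; rewrite mid ?mulr0 //.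
  - by rewrite -ltnS.
  - by rewrite orbC lt0n k0.
  by rewrite -plen_pdrop -ltnS.
rewrite cpaME pdrop0 (bigD1 ord_max) //= [X in _ + X]big1 ?addr0; last first.
  move=> j; rewrite -val_eqE /= => jp; have := mid j 0%N (leq0n _);
    rewrite pdrop0 => ->; rewrite ?mulr0 //.
    by rewrite addn0 ltnn orbF ltn_neqAle jp -ltnS ltn_ord.
  by rewrite subn0 -ltnS.
rewrite ptake_full; congr (A _ * _ * B _); apply: qpath_eq.
- by rewrite /pstart /= take_size.
- by rewrite /parrows /= drop_size.
- by [].
- by rewrite /parrows /= take0.
Qed.

Lemma derivative_value f p : mk f = 0 -> all uncut (word p) ->
  exists g, derivative_ideal S g /\
    forall q, (plen q <= plen p)%N -> all uncut (word q) -> f q = g q.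
Proof.
move/mk_eq0 => /(_ (plen p).+1)[g Ig fg] _; exists g; split=> // q qp uq.
by rewrite -fg // /deg0 degree_eq0 uq.
Qed.

(** The triangle term of a relation is not a turning word, and its puncture term already has the
    greatest length that an uncut run can have, so it fills the run. *)
Lemma turn_word_dpot u n q (a : arrow Q) :
    all uncut (traject turn u n) -> infix (word q) (traject turn u n) ->
    dpot wt (val a) q != 0 ->
  [/\ at_puncture u, n = (order turn u).-1, turn (val a) = u & word q = traject
    turn u n].
Proof.
move=> un inf /dpot_neq0[[ia qE]|[pa qE]].
  have : sorted (frel turn) (traject turn u n) by case: (n) => //= m; apply:
    fpath_traject.
  move/(infix_sorted inf); rewrite qE /= andbT => /eqP e; case/and3P:
    ia => _ _ /negP[].
  by rewrite -[X in X == _]/(turn (cw (val a))) e.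
have := uncut_run_bound un.
have := order_puncture val3 pa => o3.
have mE : traject turn (turn (val a)) (order turn (val a)).-1 =
    turn (val a) :: traject turn (turn (turn (val a))) (order turn (val a)).-2.
  by rewrite -[(order _ _).-1 in LHS]prednK //; case:
    (order _ _) o3 => [|[|[]]].
have uta : fconnect turn u (turn (val a)).
  have : turn (val a) \in traject turn u n by rewrite (mem_infix inf) // qE mE
    mem_head.
  by case/trajectP=> k _ ->; apply: fconnect_iter.
have pu : at_puncture u by rewrite (at_puncture_connect uta) at_puncture_turn.
have ou : order turn u = order turn (val a).
  rewrite -(order_step (@turn_inj tau) (val a)); apply/eq_card => z.
  exact: (same_connect (fconnect_sym (@turn_inj tau)) uta).
move=> nu; have nE : n = (order turn u).-1.
  by have := size_infix inf; rewrite qE !size_traject ou; move: nu; rewrite ou;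
    lia.
have e : word q = traject turn u n.
  case/infixP: inf => s1 [s2 e]; have := congr1 size e.
  rewrite !size_cat qE !size_traject -ou -nE => sz.
  have [s10 s20] : s1 = [::] /\ s2 = [::] by split; apply: size0nil; lia.
  by rewrite e s10 s20 cats0 /= qE -ou -nE.
split=> //; move: e; rewrite qE mE nE ou.
by case: (order _ _) o3 => [|[|[]]] //= k _ [].
Qed.

(* Among the uncut paths turning around a marked point, only those completing a
   cut arrow to the cycle of a puncture occur in elements of the ideal. *)
Lemma coord_turn f p u n : mk f = 0 -> word p = traject turn u n ->
  all uncut (traject turn u n) -> ~ (at_puncture u /\ n = (order turn u).-1) ->
  f p = 0.
Proof.
move=> f0 pE un nfull; have [|g [[s ->] fg]] := @derivative_value _ p f0.
  by rewrite pE.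
rewrite fg ?pE // cpa_sumE big1 // => -[[A a] B] _ /=.
have X0 q : infix (word q) (word p) -> cyclic_derivative a S q = 0.
  rewrite pE cyclic_derivativeE // => inf; apply/eqP; apply: contra_notT nfull.
  by move=> /(turn_word_dpot un inf)[].
by rewrite sandwich => [|q /X0//]; rewrite X0 ?infix_refl ?mulr0 ?mul0r.
Qed.

(** The two paths are the two terms of the relation at the corner [cw (cw (opp u))], and no other
    relation contributes to either coefficient; so these are in the ratio prescribed by that
    relation. *)
Lemma coord_full f p q u : mk f = 0 -> at_puncture u ->
  word p = traject turn u (order turn u).-1 -> all uncut (word p) ->
  word q = [:: opp u; cw (opp u)] -> all uncut (word q) ->
  f p = wt (marked_point u) * f q.
Proof.
move=> f0 pu pE up qE uq.
have o3 := order_puncture val3 pu.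
pose c := cw (cw (opp u)).
have cu : turn c = u by rewrite turn_cw2 opp_opp.
have pc : at_puncture c by rewrite -at_puncture_turn cu.
have oc : order turn c = order turn u by rewrite -cu order_step //; apply:
  turn_inj.
have /andP[uy /andP[ucy _]] : all uncut [:: opp u; cw (opp u)] by rewrite -qE.
have iy : internal (opp u) by apply: uncut_internal.
have [|g [[s ->] fg]] := @derivative_value _ p f0; first by [].
have szq : (plen q <= plen p)%N.
  by rewrite -!size_word qE pE size_traject /=; move: o3; lia.
rewrite !fg // !cpa_sumE mulr_sumr; apply: eq_bigr => -[[A a] B] _ /=.
have small r : infix (word r) (word q) -> (plen r < plen q)%N ->
  cyclic_derivative a S r = 0.
  rewrite cyclic_derivativeE // -!size_word qE => _ sr; apply/eqP/negPn/negP.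
  move=> /dpot_neq0[[_ e]|[pa e]]; move: sr; rewrite e //.
  by rewrite size_traject; have := order_puncture val3 pa; case:
    (order _ _) => [|[|[]]].
have smallp r : infix (word r) (word p) -> (plen r < plen p)%N ->
  cyclic_derivative a S r = 0.
  rewrite cyclic_derivativeE // -!size_word pE => inf sr; apply/eqP/negPn/negP.
  rewrite pE in up; case/(turn_word_dpot up inf) => _ _ _ e; move: sr.
  by rewrite e ltnn.
rewrite !sandwich //.
have [m mE] : exists m, (order turn u).-1 = m.+1.
  by case: (order _ _) o3 => [|[|m]] // _; exists m.
have pw : word p = u :: traject turn (turn u) m by rewrite pE mE.
have [iu nu] : inner u /\ (opp u == u) = false.
  by have [iu _] := at_puncture_inner pu; split=> //; exact: negbTE.
have es : pstart p = pstart q.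
  have [up' _] := word_cons pw; have [/arcP[_ uq'] _] := word_cons qE.
  by apply: (arc_inj up'); rewrite uq' !inE opp_opp eqxx orbT.
have ee : pend p = pend q.
  have /arcP[_ eq] : c \in val (pend q) by apply: pend_word (_ : word q =
    rcons [:: opp u] _).
  have cp : cw (iter m turn u) \in val (pend p).
    by apply: pend_word (_ : word p = rcons (traject turn u m) _);
      rewrite pE mE trajectSr.
  have cE : iter m.+1 turn u = c.
    apply: (@turn_inj tau); rewrite cu -[RHS](@iter_turn _ u _ pu (erefl _)).
    by rewrite -iterS -mE prednK //; apply: leq_trans o3.
  apply: (arc_inj cp); rewrite eq !inE; apply/orP; right.
  by rewrite -cE iterS opp_turn.
rewrite es ee.
have -> : cyclic_derivative a S p =
  wt (marked_point u) * cyclic_derivative a S q; last first.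
  by rewrite [A _ * (_ * _)]mulrCA !mulrA.
rewrite !cyclic_derivativeE //.
have [->|ac] := eqVneq (val a) c.
  have n1 : (word p == [:: cw c; cw (cw c)]) = false.
    by rewrite pw eqseq_cons cw_cw_cw eq_sym nu.
  have n2 : (word q == traject turn (turn c) (order turn c).-1) = false.
    by rewrite oc mE cu qE eqseq_cons nu.
  rewrite /dpot !cpaDE pc /mono n1 n2 internal_cw internal_cw iy cu oc -pE eqxx.
  rewrite qE cw_cw_cw eqxx !mulr0 add0r addr0 !mulr1.
  congr (wt _); rewrite !marked_point_puncture //; apply/setP => z;
    rewrite !inE.
  by rewrite (same_fconnect1 (@turn_inj tau)) cu.
have -> : dpot wt (val a) p = 0.
  apply/eqP/negPn/negP => dp; rewrite pE in up.
  have inf : infix (word p) (traject turn u (order turn u).-1) by rewrite pE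
    infix_refl.
  have [_ _ e _] := turn_word_dpot up inf dp.
  by rewrite -cu in e; rewrite (turn_inj e) eqxx in ac.
have -> : dpot wt (val a) q = 0; last by rewrite mulr0.
apply/eqP/negPn/negP => /dpot_neq0[[ia]|[pa]]; rewrite qE.
  by case=> e _; case/eqP: ac; apply: cw_inj; rewrite cw_cw_cw; exact: esym e.
move=> e; have := congr1 size e; rewrite size_traject => /esym e2.
rewrite e2 /= in e; case: e => e1 e; rewrite -e1 in e.
by have [_ /eqP[]] := and3P iy; exact: esym e.
Qed.

(** * The first syzygies of a simple module *)

Lemma vert_opp x : vert K (opp x) = vert K x.
Proof.
apply: funext => p; rewrite /vert; congr (_ && _)%:R.
by apply/idP/idP => /arcP[_ ->]; rewrite !inE ?opp_opp eqxx ?orbT.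
Qed.

Lemma mono_vert k x w : mono k (x :: w) * vert K x = mono k (x :: w).
Proof.
apply: funext => p; rewrite mulvertE /mono; case: ifPn => // xp.
case: eqP => [e|]; last by rewrite mulr0.
by have [] := word_cons e; rewrite (negPf xp).
Qed.

Lemma vert_mono k x w : vert K (cw x) * mono k (rcons w x) = mono k (rcons w x).
Proof.
apply: funext => p; rewrite vertmulE /mono; case: ifPn => // xp.
case: eqP => [e|]; last by rewrite mulr0.
by have := pend_word e; rewrite (negPf xp).
Qed.

Local Notation ev x := (mk (vert K x)).

Lemma mk_word_vert k x w : V k (x :: w) * ev x = V k (x :: w).
Proof. by rewrite -mkM mono_vert. Qed.

Lemma vert_mk_word k x w : ev (cw x) * V k (rcons w x) = V k (rcons w x).
Proof. by rewrite -mkM vert_mono. Qed.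

(* A cut arrow c ending at the arc of s sits at the corner cw (cw s), and its
   relation starts with the arrow s along the triangle, with the arrow opp s
   around the marked point. The two terms without their first arrow: *)
Definition rel_own s : Lam := V 1 [:: cw s].

Definition rel_opp s : Lam :=
  if at_puncture (cw (cw s)) then
    V (wt (marked_point (cw (cw s))))
      (traject turn (turn (opp s)) (order turn (cw (cw s))).-2)
  else 0.

(* These vanish when there is no arrow s in Lambda, or no relation coming from
   the corner cw (cw s), so that the terms of the resolution have a uniform
   description. *)
Definition idem_target s : Lam := if uncut s then ev (cw s) else 0.

Definition idem_source s : Lam := if cut (cw (cw s)) then ev (cw (cw s)) else 0.

Lemma ev_idem x : ev x * ev x = ev x.
Proof. by rewrite -mkM vert_idem. Qed.

Lemma idem_target_idem s : idem_target s * idem_target s = idem_target s.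
Proof. by rewrite /idem_target; case: ifP; rewrite ?ev_idem ?mulr0. Qed.

Lemma idem_source_idem s : idem_source s * idem_source s = idem_source s.
Proof. by rewrite /idem_source; case: ifP; rewrite ?ev_idem ?mulr0. Qed.

Lemma cut_noninternal s : cut (cw (cw s)) -> uncut s = false ->
  ~~ inner (cw s) /\ ~~ internal s.
Proof.
move=> cc us.
have ni : ~~ internal s.
  by apply/negP => /[dup] iy; move/internal_cut; rewrite cc us.
split=> //; apply: contraNN ni => ics.
have := cut_is_arrow cc; rewrite /is_arrow cw_cw_cw => /andP[icc iss].
by rewrite /internal icc iss ics.
Qed.

Lemma idem_source_opp s k n : (0 < n)%N -> at_puncture (cw (cw s)) ->
  order turn (cw (cw s)) = n.+2 ->
  ev (cw (cw s)) * V k (traject turn (turn (opp s)) n) =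
    V k (traject turn (turn (opp s)) n).
Proof.
case: n => // n _ pc oc; rewrite -turn_cw2 trajectSr.
set z := iter _ _ _.
have zE : turn z = cw (cw s).
  rewrite /z -2!iterSr -iterS; have := iter_turn pc oc; rewrite // .
by rewrite -zE vert_opp vert_mk_word.
Qed.

Lemma rel_own_target s :
  idem_source s * rel_own s * idem_target s = idem_source s * rel_own s.
Proof.
rewrite /idem_source; case: ifP => cc; last by rewrite !mul0r.
rewrite /idem_target; case: ifP => us;
  first by rewrite -mulrA /rel_own mk_word_vert.
have [ni _] := cut_noninternal cc us.
rewrite /rel_own mk_word_cut ?mulr0 ?mul0r //=.
by rewrite andbT; apply: contraNN ni => /uncut_is_arrow/andP[].
Qed.

Lemma order_predn2 x : at_puncture x -> exists n, order turn x = n.+3.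
Proof.
by move/(order_puncture val3); case: (order _ _) => [|[|[|n]]] // _; exists n.
Qed.

Lemma rel_opp_target s :
  idem_source s * rel_opp s * idem_target (opp s) = idem_source s * rel_opp s.
Proof.
rewrite /idem_source; case: ifP => cc; last by rewrite !mul0r.
rewrite /rel_opp; case: ifP => pc; last by rewrite mulr0 mul0r.
have := puncture_run_uncut pc cc.
have [n oc] := order_predn2 pc; rewrite oc /= turn_cw2 => /andP[uo _].
rewrite /idem_target uo -mulrA (_ : vert K (cw (opp s)) =
  vert K (turn (opp s))).
  by rewrite mk_word_vert.
by rewrite -[RHS]vert_opp opp_turn.
Qed.

Lemma relation_syzygy s :
  idem_source s * (rel_own s * V 1 [:: s] + rel_opp s * V 1 [:: opp s]) = 0.
Proof.
rewrite /idem_source; case: ifP => cc; last by rewrite !mul0r.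
suff -> : rel_own s * V 1 [:: s] + rel_opp s * V 1 [:: opp s] =
  mk (dpot wt (cw (cw s))).
  by rewrite (mk_dpot (cut_is_arrow cc)) mulr0.
rewrite /dpot mkD cw_cw_cw turn_cw2 !internal_cw; congr (_ + _).
  rewrite /rel_own mk_wordM mulr1 -/(V _ [:: s; cw s]) /=.
  case: (boolP (internal s)) => // ni; rewrite [RHS]mk_word0.
  apply: mk_word_cut; rewrite /= andbT; apply: contraNN ni => /andP[].
  move=> /uncut_is_arrow/andP[is1 is2] /uncut_is_arrow/andP[_ is3].
  by rewrite /internal is1 is2 is3.
rewrite /rel_opp; case: ifP => pc; last by rewrite mk0 mul0r.
by have [n ->] := order_predn2 pc; rewrite mk_wordM mulr1.
Qed.

Lemma idem_source_own s : uncut s -> idem_source s * rel_own s = rel_own s.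
Proof.
move=> us; rewrite /idem_source; case: ifPn => cc.
  by rewrite /rel_own -[[:: cw s]]/(rcons [::] (cw s)) vert_mk_word.
rewrite mul0r /rel_own mk_word_cut //= andbT; apply: contraNN cc => ucs.
have /andP[is1 is2] := uncut_is_arrow us;
  have /andP[_ is3] := uncut_is_arrow ucs.
by rewrite internal_cut ?us ?ucs // /internal is1 is2 is3.
Qed.

Lemma idem_source_rel_opp s : uncut (opp s) -> idem_source s * rel_opp s =
  rel_opp s.
Proof.
move=> uo; rewrite /rel_opp; case: ifP => pc; last by rewrite mulr0.
have [n oc] := order_predn2 pc; rewrite oc /=.
rewrite /idem_source; case: ifPn => cc; first exact:
  (@idem_source_opp _ _ n.+1).
rewrite mul0r mk_word_cut //; apply/negP => /allP run.
have := cut_puncture pc; rewrite orbit_cons oc /= turn_cw2.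
rewrite (negPf cc) (uncut_not_cut uo) !add0n => e.
have : has cut (traject turn (turn (opp s)) n.+1) by rewrite has_count /= e.
by case/hasP=> y /run/uncut_not_cut ->.
Qed.

(** The arrow [s] starts a term of only two relations: the triangle term at [cw (cw s)], and the
    puncture term at [cw (cw (opp s))], whose [turn] is [s]. *)
Lemma strip_dpot (a b : arrow Q) s : val a = s -> uncut s ->
  mk (strip a (dpot wt (val b))) * ev (cw s) =
    if val b == cw (cw s) then rel_own s
    else if val b == cw (cw (opp s)) then rel_opp (opp s) else 0.
Proof.
move=> aE us; have /andP[is1 is2] := uncut_is_arrow us.
have ios : (s == opp s) = false by rewrite eq_sym; apply/negbTE.
have stripP y : at_puncture y ->
    strip a (mono (wt (marked_point y)) (traject turn (turn y) (order turn
      y).-1)) =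
    mono (wt (marked_point y) * (s == turn y)%:R)
      (traject turn (turn (turn y)) (order turn y).-2) * vert K (cw (turn y)).
  by move=> py; have [n ->] := order_predn2 py;
    rewrite -[_.-1]/n.+2 trajectS strip_mono aE.
rewrite /dpot stripD strip_mono aE.
have [bE|bc] := eqVneq (val b) (cw (cw s)).
  have ib : internal (cw (cw s)).
    have /andP[] : is_arrow (cw (cw s)) by rewrite -bE; exact: (valP b).
    by rewrite /internal !cw_cw_cw is1 is2 => -> _.
  rewrite bE cw_cw_cw ib eqxx mulr1 mkD mulrDl [X in _ + X](_ : _ = 0) ?addr0;
    last first.
    case: ifP => pc; last by rewrite strip0 mk0 mul0r.
    by rewrite stripP // turn_cw2 ios mulr0 mono0 mul0r mk0 mul0r.
  by rewrite mkM -mulrA ev_idem -mkM mono_vert.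
have -> : (s == cw (val b)) = false.
  by apply/negbTE; apply: contraNneq bc => ->; rewrite cw_cw_cw.
rewrite mulr0 mono0 mul0r add0r.
have [bE|bc'] := eqVneq (val b) (cw (cw (opp s))).
  rewrite bE /rel_opp; case: ifP => pc; last by rewrite strip0 mk0 mul0r.
  rewrite stripP // turn_cw2 opp_opp eqxx mulr1 mkM -mulrA ev_idem -mkM.
  have [n ->] := order_predn2 pc.
  by rewrite -(vert_opp (cw s)) -[opp (cw s)]/(turn s) mono_vert.
case: ifP => pb; last by rewrite strip0 mk0 mul0r.
rewrite stripP // (_ : (s == turn (val b)) =
  false) ?mulr0 ?mono0 ?mul0r ?mk0 ?mul0r //.
apply/negbTE; apply: contraNneq bc' => sE; apply/eqP/(@turn_inj tau).
by rewrite turn_cw2 opp_opp.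
Qed.

(* Comparing the terms of an element of the ideal generated by the cyclic
   derivatives according to their first arrow. *)
Lemma first_syzygy f g s :
  mk (f * mono 1 [:: s] + g * mono 1 [:: opp s]) = 0 -> inner s ->
  exists A B : Lam,
    (uncut s -> mk f * ev (cw s) = A * rel_own s + B * rel_opp (opp s)) /\
    (uncut (opp s) -> mk g * ev (cw (opp s)) =
      B * rel_own (opp s) + A * rel_opp s).
Proof.
(* Removing one arrow costs one degree of accuracy, hence the successor: the stripped series agree
   below [word_bound], and longer words vanish. *)
set h := _ + _ => /mk_eq0 /(_ word_bound.+1)[D [t DE] hD] is1.
have [i si] : exists i : vertex Q, s \in val i.
  by exists (arc_of is1); rewrite !inE eqxx.
(* For each occurrence of the relation at [y], its left factor is weighted by the constant
   coefficient of the right factor at [i]. If the right factor contains the first arrow, the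
   relation stays intact and the product remains in the ideal. *)
pose T y := \sum_(u <- t | val u.1.2 == y) mk (mono (u.2 (ptriv i)) [::]) * mk
  u.1.1.
exists (T (cw (cw s))), (T (cw (cw (opp s)))).
have stripD_E x (a : arrow Q) : val a = x -> x \in val i -> uncut x ->
    mk (strip a (deg0 h)) * ev (cw x) =
    T (cw (cw x)) * rel_own x + T (cw (cw (opp x))) * rel_opp (opp x).
  move=> aE xi ux; have sa : source a = i by apply/eqP; rewrite sourceE aE.
  have ix : inner x by case/arcP: xi.
  have -> : mk (strip a (deg0 h)) = mk (strip a D).
    apply/eqP; rewrite -subr_eq0 -mkB; apply/eqP/mk_eq0_words => // p.
    case: (leqP word_bound (plen p)) => [pb _|pb].
      by apply: mk_word_bound => //; rewrite size_word.
    rewrite cpaDE cpaNE; have [ap|nap] := eqVneq (target a) (pstart p).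
      have [q qE] := path_cons ap; rewrite !(stripE _ qE) // hD ?subrr ?eqxx //.
      by rewrite -size_word qE /= size_word.
    by rewrite !strip_eq0 ?subrr ?eqxx.
  rewrite DE strip_sum mk_sum mulr_suml.
  transitivity (\sum_(u <- t) mk (mono (u.2 (ptriv i)) [::]) * mk u.1.1 *
      (mk (strip a (dpot wt (val u.1.2))) * ev (cw x))).
    apply: eq_bigr => -[[A b] B] _ /=; rewrite -cyclic_derivativeE //.
    rewrite strip_mul mkD !mkM [mk (cyclic_derivative _ _)]mk_jacobian //;
      last first.
      by apply: derivative_in_jacobian; exists [:: (1, b, 1)];
        rewrite big_seq1 mul1r mulr1.
    rewrite mulr0 mul0r add0r sa strip_mul.
    rewrite (_ : cyclic_derivative b S (ptriv (source a)) = 0); last first.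
      rewrite cyclic_derivativeE //;
        apply/eqP/negPn/negP => /dpot_neq0[[_ //]|[pb]].
      by have [n ->] := order_predn2 pb.
    by rewrite mono0 mul0r addr0 mkM !mulrA.
  rewrite /T !mulr_suml [X in X + _]big_mkcond [X in _ + X]big_mkcond
    -big_split /=; apply: eq_bigr => u _.
  rewrite (strip_dpot _ aE ux); have [->|_] := eqVneq (val u.1.2) (cw (cw x)).
    case: eqP => [/cw_inj/cw_inj e|]; rewrite ?addr0 //.
    by move: ix; rewrite /inner -e eqxx.
  by case: eqP; rewrite ?add0r ?mulr0 ?addr0.
have osi : opp s \in val i by case/arcP: si => _ ->; rewrite !inE eqxx orbT.
have mk_deg0 f' : mk (deg0 f') = mk f'.
  by apply: val_inj; rewrite /= (deg0_id (@deg0_homogeneous _ _ _ _)).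
have sos : (s == opp s) = false by rewrite eq_sym; apply/negbTE.
have mono_deg0 x : deg0 (mono 1 [:: x]) = if uncut x then mono 1 [:: x] else 0.
  case ux: (uncut x); apply: funext => p; rewrite /deg0 degree_eq0 /mono;
    by case: eqP => [->|_]; rewrite /= ?ux // mulr0 if_same.
have strip_h x (a : arrow Q) : val a = x -> uncut x -> strip a (deg0 h) =
    (if x == s then deg0 f * vert K (cw s) else 0) +
    (if x == opp s then deg0 g * vert K (cw (opp s)) else 0).
  move=> aE ux; rewrite /h deg0D !deg0M !mono_deg0 stripD; congr (_ + _).
    case: ifPn => us; first by rewrite strip_mul_mono aE.
    by rewrite mulr0 strip0; case: eqP ux us => // -> ->.
  case: ifPn => us; first by rewrite strip_mul_mono aE.
  by rewrite mulr0 strip0; case: eqP ux us => // -> ->.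
split=> us.
  have ax := uncut_is_arrow us; pose a : arrow Q := exist _ s ax.
  rewrite -(stripD_E s a) // (strip_h s a) // eqxx sos addr0.
  by rewrite mkM mk_deg0 -mulrA ev_idem.
have ax := uncut_is_arrow us; pose a : arrow Q := exist _ (opp s) ax.
have := stripD_E (opp s) a; rewrite opp_opp => <- //.
rewrite (strip_h (opp s) a) // eqxx eq_sym sos add0r.
by rewrite mkM mk_deg0 -mulrA ev_idem.
Qed.

(** * The kernel of P2 -> P1 *)

(** Exactness at P0: a path of positive length starting at [i] begins with one of the two possible
    arrows [s] and [opp s]. *)
Lemma first_arrows f s i : s \in val (i : vertex Q) -> f (ptriv i) = 0 ->
  exists A B : Lam,
    mk f * ev s =
      A * idem_target s * V 1 [:: s] + B * idem_target (opp s) * V 1 [:: opp s].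
Proof.
move=> si fi.
pose G (a : arrow Q) := mk (strip a f) * V 1 [:: val a].
pose U x := \sum_(a : arrow Q | val a == x) mk (strip a f).
have UE x : U x * idem_target x * V 1 [:: x] =
  \sum_(a : arrow Q | val a == x) G a.
  rewrite -mulrA mulr_suml; apply: eq_bigr => a /eqP <-; congr (_ * _).
  rewrite /idem_target; case: ifPn => ua;
    last by rewrite mul0r mk_word_cut //= andbT.
  by rewrite -[[:: val a]]/(rcons [::] (val a)) vert_mk_word.
exists (U s), (U (opp s)); rewrite !UE -mkM mk_strip //.
have -> : trivial_part (f * vert K s) = 0.
  apply: funext => p; rewrite /trivial_part; case: eqP => // p0;
    rewrite mulvertE.
  case: ifP => // sp; suff -> : p = ptriv i by [].
  apply: qpath_eq; first exact: arc_inj sp si.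
  by rewrite /parrows /=; apply: size0nil.
have is1 : inner s by case/arcP: si.
rewrite mk0 add0r [in RHS]big_mkcond [X in _ + X]big_mkcond -big_split /=.
suff key (a : arrow Q) : mk (strip a (f * vert K s)) * V 1 [:: val a] =
    (if val a == s then G a else 0) + (if val a == opp s then G a else 0).
  by apply: eq_bigr => a _; apply: key.
rewrite strip_mul (_ : strip a (vert K s) = 0) ?mulr0 ?add0r; last first.
  apply: funext => p; have [ap|nap] := eqVneq (target a) (pstart p).
    by have [q qE] := path_cons ap;
      rewrite (stripE _ qE) // /vert -size_word qE.
  by rewrite strip_eq0.
have -> : vert K s (ptriv (source a)) = ((val a == s) || (val a == opp s))%:R.
  rewrite /vert /plen /parrows /pstart [X in (X && _)]/= andTb.
  have -> : (s \in val (source a)) = (source a == i).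
    by apply/idP/eqP => [sa|->]; [apply: arc_inj sa si | exact: si].
  by rewrite sourceE; case/arcP: si => _ ->; rewrite !inE.
have [as1|nas] := eqVneq (val a) s.
  by rewrite as1 eq_sym (negPf is1) /= addr0 mono1 mul1r /G as1.
rewrite add0r /=; case: eqP => _; first by rewrite mono1 mul1r.
by rewrite mono0 mul0r mk0 mul0r.
Qed.

(** A representative of [rel_opp s]: coefficients are read in the complete path algebra, not in
    Lambda. *)
Definition rel_opp_series s : cpa K Q :=
  if at_puncture (cw (cw s)) then
    mono (wt (marked_point (cw (cw s))))
      (traject turn (turn (opp s)) (order turn (cw (cw s))).-2)
  else 0.

Lemma rel_opp_seriesE s : rel_opp s = mk (rel_opp_series s).
Proof. by rewrite /rel_opp /rel_opp_series; case: ifP; rewrite ?mk0. Qed.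

Definition supported_at_source s f := forall p, f p != 0 ->
  cut (cw (cw s)) /\ cw (cw s) \in val (pstart p).

(** The series [f] and [g] represent the two components of an element of the kernel of P2 -> P1. *)
Definition syzygy s f g := [/\ supported_at_source s f, supported_at_source
  (opp s) g,
  mk (f * mono 1 [:: cw s] + g * rel_opp_series (opp s)) = 0 &
  mk (g * mono 1 [:: cw (opp s)] + f * rel_opp_series s) = 0].

Lemma syzygy_sym s f g : syzygy s f g -> syzygy (opp s) g f.
Proof. by case=> fs gs e1 e2; split; rewrite ?opp_opp. Qed.

Lemma pdrop_all p : pdrop (size (word p)) p = ptriv (pend p).
Proof.
rewrite size_word; apply: qpath_eq; rewrite /pstart /parrows /= ?drop_size //.
by rewrite take_size.
Qed.

Lemma mul_rel_opp_prefix s f p x w : word p = x :: w -> x != turn (opp s) ->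
  (f * rel_opp_series s) p = 0.
Proof.
move=> pE nx; rewrite /rel_opp_series; case: ifP => pc; last by rewrite mulr0.
have [n ->] := order_predn2 pc.
by rewrite mulmonoE pE /= eq_sym (negPf nx).
Qed.

Lemma turn_path_exists x n : all uncut (traject turn x n) -> (0 < n)%N ->
  exists p, word p = traject turn x n.
Proof.
case: n => // n un _; apply: path_of_word.
  by apply: sub_all un => y; apply: uncut_is_arrow.
have : fpath turn x (traject turn (turn x) n) by exact: fpath_traject.
by apply: sub_path => y z /eqP <-; rewrite /step eqxx orbT.
Qed.

(** This puts the kernel in the radical. A constant term of [f] would appear as the coefficient of
    [cw s] in the first equation if the triangle is internal, and of a puncture run lacking two
    arrows in the second one otherwise. Both runs are too short to be the term of a relation. *)
Lemma syzygy_trivial s f g v : syzygy s f g -> f (ptriv v) = 0.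
Proof.
case=> fs _ e1 e2; apply/eqP/negPn/negP => fv; have [cc cv] := fs _ fv.
have /andP[icc is1] := cut_is_arrow cc; rewrite cw_cw_cw in is1.
have [ic|nic] := boolP (internal s).
  have [us ucs] : uncut s /\ uncut (cw s).
    by move: cc; rewrite internal_cut // => /andP[].
  have [|//|p pE] := @path_of_word _ (cw s) [::];
    first by rewrite /= (uncut_is_arrow ucs).
  have /andP[ics _] := uncut_is_arrow ucs.
  have := coord_turn e1 (pE : word p = traject turn (cw s) 1).
  rewrite /= ucs => /(_ isT) F1.
  case/eqP: fv; rewrite -[RHS]F1; last by case=> /order_predn2[n ->].
  rewrite cpaDE (mul_rel_opp_prefix _ pE) ?opp_opp; last by rewrite eq_sym;
    apply: ics.
  rewrite addr0 mulmonoE pE /= eqxx mulr1; congr (f _).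
  have -> : pdrop 1 p = ptriv (pend p) by rewrite -pdrop_all pE.
  congr (ptriv _); apply: arc_inj cv _.
  by apply: (@pend_word _ p _ [::]); rewrite pE.
have pc : at_puncture (cw (cw s)).
  by have := cut_in_potential cc; rewrite !internal_cw (negPf nic).
have [n oc] := order_predn2 pc.
have run0 := puncture_run_uncut pc cc; rewrite oc turn_cw2 in run0.
have [uo run] : uncut (opp s) /\ all uncut (traject turn (turn (opp s)) n.+1).
  by move/andP: run0.
have [p pE] := turn_path_exists run isT.
have oto : order turn (turn (opp s)) = n.+3.
  by rewrite -oc -turn_cw2 !order_step //; apply: turn_inj.
have := coord_turn e2 (pE : word p = traject turn (turn (opp s)) n.+1).
rewrite oto => /(_ run) F2.
have {F2} : f (ptriv v) * wt (marked_point (cw (cw s))) = 0.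
  rewrite -[RHS]F2; last by case=> _ /n_Sn.
  have /andP[_ ico] := uncut_is_arrow uo.
  rewrite cpaDE mulmonoE pE /= eq_sym [turn (opp s) == _](negPf ico) add0r.
  rewrite /rel_opp_series pc oc mulmonoE pE prefix_refl.
  rewrite -pE pdrop_all; congr (f (ptriv _) * _); apply: arc_inj cv _.
  have : cw (iter n turn (turn (opp s))) \in val (pend p).
    by apply: (@pend_word _ p _ (traject turn (turn (opp s)) n));
      rewrite pE -trajectSr.
  case/arcP=> _ ->; rewrite !inE; apply/orP; right.
  have := iter_turn pc oc; rewrite iterSr turn_cw2 iterSr => {1}<-.
  by rewrite iterS.
by move/eqP; rewrite mulf_eq0 (negPf fv) (negPf (wt_neq0 pc)).
Qed.

(* Configurations (I) and (II) at a given side of the arc i: in (I) the side of i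
   is s, in (II) it is cw z. *)
Definition corner_I s := [/\ internal s, at_puncture (cw s), cut (cw (cw s)) &
  let y := opp (cw s) in
  [/\ ~~ inner (cw y), inner (cw (cw y)) & cut (cw (cw y))]].

Definition corner_II z := [/\ inner z && ~~ inner (cw (cw z)), at_puncture z,
  cut z & internal (opp z) && cut (cw (opp z))].

(* Across an arc k with a cut corner of a non-internal triangle at its end, the
   quiver continues with an uncut arrow only in configuration (II). *)
Lemma noninternal_continuation s : cut (cw (cw s)) -> ~~ internal s ->
  uncut (opp (cw (cw s))) -> corner_II (cw (cw s)).
Proof.
move=> cc ni uc; set c := cw (cw s) in cc uc *.
have pc : at_puncture c.
  by have := cut_in_potential cc; rewrite !internal_cw (negPf ni).
have [n oc] := order_predn2 pc.
have /andP[ic is1] := cut_is_arrow cc.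
pose l := cw (cw (opp c)).
have tl : turn l = c by rewrite turn_cw2 opp_opp.
have pl : at_puncture l by rewrite -at_puncture_turn tl.
have [il _] := at_puncture_inner pl.
have io : internal (opp c) by have /andP[i1 i2] := uncut_is_arrow uc;
  rewrite /internal i1 i2 il.
(* Two cut corners at one puncture coincide, and [turn l = l] would contradict the valency. *)
have ncl : ~~ cut l.
  apply/negP => cl; have lc : l = c.
    by apply: cut_at_puncture_unique => //; rewrite -tl; apply: fconnect1.
  have : uniq (orbit turn c) by apply: orbit_uniq.
  by rewrite orbit_cons oc /= -{2}lc tl inE eqxx.
split=> //; last first.
  rewrite io; have := cut_internal io.
  by rewrite (uncut_not_cut uc) (negPf ncl) add0n addn0; case: cut.
rewrite ic; apply: contraNN ni => icc; rewrite -internal_cw -internal_cw -/c.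
by rewrite /internal ic is1 icc.
Qed.

(** In the first equation [f p] is the coefficient of [cw s] followed by [p]. If it is not 0, this
    path is a full run around a puncture, so the two-arrow path in the triangle across [cw s] has
    nonzero coefficient too. Only [g] can produce that, through a puncture of valency 3, and the
    resulting path of [g] has the shape assumed of [p], at [opp s]. *)
Lemma syzygy_half s f g p n : syzygy s f g ->
    ~ corner_I s -> ~ corner_II (cw (cw s)) ->
    word p = traject turn (opp (cw (cw s))) n.+1 -> all uncut (word p) ->
      f p != 0 ->
  [/\ at_puncture (cw s) /\ order turn (cw s) = n.+3,
      at_puncture (cw (cw (opp s))) /\ order turn (cw (cw (opp s))) = 3 &
      exists q, [/\ word q = [:: opp (cw (cw (opp s)))], all uncut (word q) & g
        q != 0]].
Proof.
move=> [fs gs e1 e2] nI nII pE up fp.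
have [cc _] := fs _ fp.
have uc : uncut (opp (cw (cw s))) by move: up; rewrite pE => /andP[].
have ii : internal s.
  by apply/negPn/negP => ni; apply: nII; apply: noninternal_continuation.
have /andP[us ucs] : uncut s && uncut (cw s) by rewrite -internal_cut.
have /andP[_ ics] := uncut_is_arrow us.
have tcs : turn (cw s) = opp (cw (cw s)) by [].
have un : all uncut (traject turn (cw s) n.+2) by rewrite /= ucs;
  rewrite pE in up.
have [p' p'E] := turn_path_exists un isT.
have F1E q w : word q = cw s :: w ->
    (f * mono 1 [:: cw s] + g * rel_opp_series (opp s)) q = f (pdrop 1 q).
  move=> qE; rewrite cpaDE (mul_rel_opp_prefix _ qE) ?opp_opp; last first.
    by rewrite eq_sym; apply: ics.
  by rewrite addr0 mulmonoE qE /= eqxx prefix0s mulr1.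
have pp' : pdrop 1 p' = p.
  by apply: word_inj_cons pE; rewrite word_pdrop p'E.
have full : at_puncture (cw s) /\ n.+2 = (order turn (cw s)).-1.
  apply: contrapT => nf; case/eqP: fp.
  by rewrite -pp' -(F1E p' _ p'E); apply: coord_turn e1 p'E un nf.
have [pcs o2] := full.
have ocs : order turn (cw s) = n.+3 by have [m om] := order_predn2 pcs; move:
  o2; rewrite om => -[->].
pose y := opp (cw s); pose v := cw (cw y).
have tv : turn v = cw s by rewrite turn_cw2 opp_opp.
have pv : at_puncture v by rewrite -at_puncture_turn tv.
have ov : order turn v = n.+3 by rewrite -ocs -tv order_step //; apply:
  turn_inj.
(* The uncut run from [cw s] covers all corners of the puncture except [v]. *)
have cv : cut v.
  have := cut_puncture pv; rewrite orbit_cons tv ov.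
  rewrite -[n.+3.-1]/n.+2 -cat1s count_cat /= addn0.
  suff -> : (cut (cw s) + (cut (turn (cw s)) + count cut (traject turn (turn
    (turn (cw s))) n)))%N = 0%N.
    by rewrite addn0; case: cut.
  apply/eqP; rewrite -leqn0 leqNgt -[X in (0 < X)%N]/(count cut (traject turn
    (cw s) n.+2)).
  rewrite -has_count -all_predC.
  by apply: sub_all un => z /uncut_not_cut /= ->.
have iy : internal y.
  apply/negPn/negP => niy; apply: nI; split=> //.
  have [iv icv] := at_puncture_inner pv; split=> //.
  apply: contraNN niy => icy; rewrite /internal icy -/v iv andbT /=.
  by rewrite /y inner_opp ics.
have /andP[uy ucy] : uncut y && uncut (cw y) by rewrite -internal_cut.
have [|/=|q qE] := @path_of_word _ y [:: cw y].
- by rewrite /= (uncut_is_arrow uy) (uncut_is_arrow ucy).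
- by rewrite /step eqxx.
have uq : all uncut (word q) by rewrite qE /= uy ucy.
have p'E' : word p' = traject turn (cw s) (order turn (cw s)).-1 by rewrite p'E
  ocs.
have up' : all uncut (word p') by rewrite p'E.
have := coord_full e1 pcs p'E' up' qE uq.
rewrite (F1E p' _ p'E) pp' => fE.
have : (f * mono 1 [:: cw s] + g * rel_opp_series (opp s)) q != 0.
  by apply: contraNneq fp => q0; rewrite fE q0 mulr0.
have csy : (cw s == y) = false by rewrite eq_sym; apply/negbTE.
rewrite cpaDE mulmonoE qE [prefix _ _]/= csy add0r /rel_opp_series; case:
  ifP => pc'; last by rewrite mulr0 eqxx.
have [m om] := order_predn2 pc'; rewrite om opp_opp mulmonoE qE.
case: ifP => // pre; last by rewrite eqxx.
(* The prefix turns around a marked point while [q] continues inside a triangle, so the prefix is a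
   single letter. *)
have m0 : m = 0%N.
  case: (m) pre => //= k; rewrite eqxx /= => /andP[/eqP e _]; exfalso.
  have /andP[icy _] := uncut_is_arrow ucy.
  by move/eqP: icy; apply; rewrite -[RHS]e.
rewrite m0 /= mulf_eq0 negb_or => /andP[gq _].
split=> //.
have w1 : word (pdrop 1 q) = [:: cw y] by rewrite word_pdrop qE.
exists (pdrop 1 q); split=> //; last by rewrite w1 /= ucy.
rewrite w1; congr [:: _]; apply: (@opp_inj tau); rewrite opp_opp.
have := iter_turn pc' om; rewrite m0 /= turn_cw2 opp_opp => <-.
by [].
Qed.

(** A path of [f] with nonzero class would, by [syzygy_half], give one of [g]. Applying the same
    lemma on the other side yields three punctures of valency 3, hence the tetrahedron. *)
Lemma syzygy_zero s f g : syzygy s f g ->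
    ~ corner_I s -> ~ corner_II (cw (cw s)) ->
    ~ corner_I (opp s) -> ~ corner_II (cw (cw (opp s))) -> mk f = 0.
Proof.
move=> sfg nI nII nI' nII'; apply: mk_eq0_words => // p fp.
case: (eqVneq (V 1 (word p)) 0) => // nz; exfalso.
have [fs _ _ _] := sfg; have [cc cp] := fs _ fp.
have up : all uncut (word p) by apply: contraNT nz => /(mk_word_cut 1) ->.
case pE : (word p) => [|x w].
  suff : f p = 0 by apply/eqP.
  have -> : p = ptriv (pstart p); last by exact: (syzygy_trivial _ sfg).
  apply: qpath_eq => //; rewrite /parrows /=.
  by apply: size0nil; have := size_word p; rewrite pE.
have [xp st] := word_cons pE.
have ux : uncut x by move: up; rewrite pE => /andP[].
have xE : x = opp (cw (cw s)).
  move: xp; case/arcP: cp => _ ->; rewrite !inE => /orP[]/eqP // e.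
  by have := uncut_not_cut ux; rewrite e cc.
have fx : fpath turn x w.
  apply: contraNT nz => nf; apply/eqP; rewrite pE.
  case: w nf st {pE} => // b [|b' w] nf st; last exact: mk_word_not_turn.
  move: nf st; rewrite /= !andbT /step eq_sym => nb;
    rewrite (negPf nb) orbF => /eqP ->.
  (* The substituted run starts with [opp x], which is the cut arrow [cw (cw s)]. *)
  have [//|[_ _ _ px ->]] := mk_word_cw x.
  have [n ->] := order_predn2 px; apply: mk_word_cut.
  by rewrite xE opp_opp /= /uncut cc andbF.
have pT : word p = traject turn (opp (cw (cw s))) (size w).+1.
  by rewrite pE (fpathE fx) size_traject xE.
have [[pcs ocs] [pc' oc'] [q [qE uq gq]]] := syzygy_half sfg nI nII pT up fp.
have := @syzygy_half (opp s) g f q 0 (syzygy_sym sfg) nI' nII' qE uq gq.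
rewrite opp_opp => -[[pco oco] [pc oc] _].
exact: (three_punctures_of_valency3 pc oc pc' oc' pco oco boundary).
Qed.

Lemma mk_word_turn_neq0 u n : all uncut (traject turn u n.+1) ->
  ~ (at_puncture u /\ n.+1 =
    (order turn u).-1) -> V 1 (traject turn u n.+1) <> 0.
Proof.
move=> un nf V0; have [p pE] := turn_path_exists un isT.
have := coord_turn V0 pE un nf.
by rewrite /mono pE eqxx mulr1 => /eqP; rewrite oner_eq0.
Qed.

(** In a non-internal triangle the relation of the cut corner consists of its puncture term alone,
    with a nonzero scalar. *)
Lemma mk_word_puncture_run v : cut v -> at_puncture v -> ~~ internal v ->
  V 1 (traject turn (turn v) (order turn v).-1) = 0.
Proof.
move=> cv pv niv; apply: (@mk_word_eq0E (wt (marked_point v))); first exact: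
  wt_neq0.
have := mk_dpot (cut_is_arrow cv).
by rewrite /dpot (negPf niv) pv mkD mono0 mk0 add0r.
Qed.

(** At the junction turning would lead to [cw (cw s)], but the path takes the other side of that
    arc. So it is not a turning path, and it vanishes unless it has just two arrows. *)
Lemma mk_word_join k s m n : inner (cw (cw s)) -> at_puncture (cw (cw s)) ->
    order turn (cw (cw s)) = m.+3 ->
  V k (traject turn (turn (opp s)) m.+1 ++ traject turn (opp (cw (cw s))) n.+1)
    = 0
  \/ [/\ m = 0%N, n = 0%N & opp (cw (cw s)) = cw (turn (opp s))].
Proof.
move=> ic pc oc.
have last_turn : turn (iter m turn (turn (opp s))) = cw (cw s).
  by have := iter_turn pc oc; rewrite iterSr turn_cw2 iterSr iterS.
have [/eqP|pos] := posnP (m + n).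
  rewrite addn_eq0 => /andP[/eqP m0 /eqP n0]; right; split=> //.
  by rewrite -last_turn m0 opp_turn.
left; apply: mk_word_not_turn => //.
  by rewrite size_cat !size_traject; lia.
rewrite cat_path last_traject /= last_turn eq_sym.
by rewrite (negPf (_ : opp (cw (cw s)) != _)) ?andbF.
Qed.

(** The only obstruction is the product of the run with [rel_opp s]. If it is not 0, it is a pair of
    arrows of a triangle, which the rewriting rule turns into a run starting with [cw (opp s)]; the
    remainder of this run, with the opposite sign, is [B]. *)
Lemma kernel_element s n : cut (cw (cw s)) ->
    V 1 (cw s :: traject turn (opp (cw (cw s))) n.+1) = 0 ->
    (at_puncture (cw (cw (opp s))) -> V 1 [:: turn s; cw (turn s)] = 0) ->
  exists B, [/\ V 1 (traject turn (opp (cw (cw s))) n.+1) * rel_own s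
                  + B * rel_opp (opp s) = 0,
                B * rel_own (opp s)
                  + V 1 (traject turn (opp (cw (cw s))) n.+1) * rel_opp s = 0
              & B * idem_source (opp s) = B].
Proof.
move=> cc own0 opp0; set w := traject _ _ _ in own0 *.
have /andP[icc _] := cut_is_arrow cc.
have own : V 1 w * rel_own s = 0 by rewrite mk_wordM mulr1.
suff [opps|[B [B1 B2 B3]]] : V 1 w * rel_opp s = 0 \/ exists B,
    [/\ B * rel_opp (opp s) = 0, B * rel_own (opp s) + V 1 w * rel_opp s = 0
      & B * idem_source (opp s) = B].
- by exists 0; rewrite own opps !mul0r addr0.
- by exists B; rewrite own B1 addr0.
rewrite /rel_opp; case: ifP => pc; last by left; rewrite mulr0.
have [m oc] := order_predn2 pc; rewrite oc mk_wordM mul1r.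
have [->|[m0 n0 ocE]] := mk_word_join (wt (marked_point (cw (cw s)))) n icc pc
  oc; first by left.
rewrite m0 /w n0 /= ocE.
have run := puncture_run_uncut pc cc.
have uo : uncut (opp s) by move: run; rewrite oc /= turn_cw2 => /andP[].
have [e|[_ _ _ pt e]] := mk_word_cw (turn (opp s)).
  by left; apply: mk_word_eq0.
rewrite e opp_turn; have [m' om'] := order_predn2 pt; rewrite om'.
set k := - _.
have [uco|nuco] := boolP (uncut (cw (opp s))); last first.
  by left; apply: mk_word_cut; rewrite /= (negPf nuco).
have co : cut (cw (cw (opp s))).
  by rewrite internal_cut ?uo ?uco //; apply: uncut_internal uco.
have /andP[icco _] := cut_is_arrow co.
right; exists (V (- k) (traject turn (turn (cw (opp s))) m'.+1)); split.
- case: ifP => pco; last by rewrite mulr0.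
  have [r oco] := order_predn2 pco; rewrite oco opp_opp mk_wordM.
  set k' := _ * _.
  have := mk_word_join k' m' icco pco oco; rewrite opp_opp.
  case=> [//|[r0 m'0 ocoE]].
  rewrite r0 m'0 /= -[turn (cw (opp s))]/(opp (cw (cw (opp s)))) ocoE.
  exact/mk_word_eq0/opp0.
- by rewrite mk_wordM mulr1 mk_wordN addNr.
- rewrite /idem_source co -[turn (cw (opp s))]/(opp (cw (cw (opp s)))).
  by rewrite -(vert_opp (cw (cw (opp s)))) mk_word_vert.
Qed.

(** In (I), [A] is the run around the puncture which completes [cw s] to the puncture term of a
    relation with no triangle term, so the product is 0. In (II), [A] is the single arrow
    [opp (cw (cw s))], and the product is 0 since [cw s] is a boundary segment. *)
Lemma corner_kernel s : corner_I s \/ corner_II (cw (cw s)) -> exists A B,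
  [/\ A <> 0, A * idem_source s = A, B * idem_source (opp s) = B,
      A * rel_own s + B * rel_opp (opp s) = 0
    & B * rel_own (opp s) + A * rel_opp s = 0].
Proof.
move=> cs.
suff [n [cc A0 own0 opp0]] : exists n,
    [/\ cut (cw (cw s)), V 1 (traject turn (opp (cw (cw s))) n.+1) <> 0,
        V 1 (cw s :: traject turn (opp (cw (cw s))) n.+1) = 0
      & at_puncture (cw (cw (opp s))) -> V 1 [:: turn s; cw (turn s)] = 0].
  have [B [e1 e2 eB]] := kernel_element cc own0 opp0.
  exists (V 1 (traject turn (opp (cw (cw s))) n.+1)), B; split=> //.
  by rewrite /idem_source cc -(vert_opp (cw (cw s))) mk_word_vert.
case: cs => [[is1 pcs cc [nicy iccy cv]]|[/andP[_ nis] pc cc /andP[io co]]].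
  set v := cw (cw _) in iccy cv.
  have tv : turn v = cw s by rewrite turn_cw2 opp_opp.
  have pv : at_puncture v by rewrite -at_puncture_turn tv.
  have niv : ~~ internal v.
    by apply: contraNN nicy; rewrite !internal_cw => /and3P[].
  have [n ocs] := order_predn2 pcs.
  have ov : order turn v = n.+3 by rewrite -ocs -tv order_step //; apply:
    turn_inj.
  have run := puncture_run_uncut pv cv; rewrite tv ov in run.
  have zero := mk_word_puncture_run cv pv niv; rewrite tv ov in zero.
  exists n; split=> //.
  - apply: mk_word_turn_neq0; first by case/andP: run.
    rewrite -[opp (cw (cw s))]/(turn (cw s)) order_step; last exact: turn_inj.
    by rewrite ocs => -[_ /n_Sn].
  - move=> _; have [//|[_ _ _ _ ->]] := mk_word_cw (turn s).
    by rewrite -[turn s]/(opp (cw s)) -/v opp_opp ov; apply: mk_word_eq0.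
exists 0; split=> //.
- apply: mk_word_turn_neq0; first by rewrite /= internal_uncut // andbT;
  have := cut_internal io; rewrite co; case: cut => //; case: cut.
  by case=> /order_predn2[n ->].
- apply: mk_word_cut => /=; apply/negP => /andP[/uncut_is_arrow/andP[ics _] _].
  by rewrite cw_cw_cw ics in nis.
- rewrite -at_puncture_turn turn_cw2 opp_opp => /at_puncture_inner[_ ics].
  by rewrite cw_cw_cw ics in nis.
Qed.

Lemma to_syzygy s (A B : Lam) : A * idem_source s =
  A -> B * idem_source (opp s) = B ->
  A * rel_own s + B * rel_opp (opp s) = 0 ->
  B * rel_own (opp s) + A * rel_opp s = 0 ->
  exists f g, [/\ A = mk f, B = mk g & syzygy s f g].
Proof.
have source r (C : Lam) : C * idem_source r = C ->
    exists2 f, C = mk f & supported_at_source r f.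
  rewrite /idem_source; have [f ->] := mk_surj C; case: ifP => cr.
    rewrite -mkM => e; exists (f * vert K (cw (cw r))); first by rewrite e.
    by move=> p; rewrite mulvertE; case: ifP => //; rewrite eqxx.
  by rewrite mulr0 => <-; exists 0; rewrite ?mk0 // => p; rewrite cpa0E eqxx.
move=> /source[f -> fs] /source[g -> gs]; rewrite !rel_opp_seriesE /rel_own.
by rewrite -!mkM -!mkD => e1 e2; exists f, g.
Qed.

(** * Projective dimension of the simple modules *)

Lemma configuration_I_corner (i : vertex Q) s : s \in val i ->
  configuration_I d i <-> corner_I s \/ corner_I (opp s).
Proof.
move=> si; have [_ iE] := arcP si; split=>
  [[x [xi ix px /degree_oneP cx [y1 y2 /degree_oneP y3]]]|].
  by move: xi; rewrite iE !inE => /orP[]/eqP <-; [left|right]; split.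
have osi : opp s \in val i by rewrite iE !inE eqxx orbT.
case=> -[is1 ps cs [y1 y2 y3]]; [exists s | exists (opp s)]; split=> //;
  by [apply/degree_oneP | split=> //; apply/degree_oneP].
Qed.

Lemma configuration_II_corner (i : vertex Q) s : s \in val i ->
  configuration_II d i <-> corner_II (cw (cw s)) \/ corner_II (cw (cw (opp s))).
Proof.
move=> si; have [_ iE] := arcP si; split=>
  [[z [zi iz pz /degree_oneP cz [y1 /degree_oneP y2]]]|].
  have cII : corner_II z by split=> //; rewrite y1 y2.
  by move: zi; rewrite iE !inE => /orP[]/eqP <-; [left|right]; rewrite cw_cw_cw.
have osi : opp s \in val i by rewrite iE !inE eqxx orbT.
have conf z : cw z \in val i -> corner_II z -> configuration_II d i.
  move=> zi [iz pz cz /andP[y1 y2]]; exists z; split=> //;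
    first exact/degree_oneP.
  by split=> //; apply/degree_oneP.
by case; apply: conf; rewrite cw_cw_cw.
Qed.

Lemma rel_own_in_target s :
  idem_source s * rel_own s \in fixed_by (idem_target s).
Proof. by rewrite unfold_in; apply/eqP; apply: rel_own_target. Qed.

Lemma rel_opp_in_target s :
  idem_source s * rel_opp s \in fixed_by (idem_target (opp s)).
Proof. by rewrite unfold_in; apply/eqP; apply: rel_opp_target. Qed.

Lemma rel_opp_in_target' s :
  idem_source (opp s) * rel_opp (opp s) \in fixed_by (idem_target s).
Proof. by have := rel_opp_in_target (opp s); rewrite opp_opp. Qed.

Lemma arrow_in_ev s : V 1 [:: s] \in fixed_by (ev s).
Proof. by rewrite unfold_in mk_word_vert. Qed.

Lemma opp_arrow_in_ev s : V 1 [:: opp s] \in fixed_by (ev s).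
Proof. by rewrite unfold_in -vert_opp mk_word_vert. Qed.

Section Resolution.
Variables (i : vertex Q) (s : side tau).
Hypothesis si : s \in val i.
Local Notation M := (simple_module (potential_no_short_cycles wt val3) d i).

Local Notation P0 := (left_ideal (ev s)).
Local Notation P1 :=
  (left_ideal (idem_target s) * left_ideal (idem_target (opp s)))%type.
Local Notation P2 :=
  (left_ideal (idem_source s) * left_ideal (idem_source (opp s)))%type.

Lemma simple_resolution :
  exists (e : {linear P0 -> M}) (d1 : {linear P1 -> P0})
    (d2 : {linear P2 -> P1}),
  [/\ forall m, exists u, e u = m,
      forall u, e u = 0 <-> exists v, d1 v = u,
      forall v, d1 v = 0 <-> exists t, d2 t = v
    & forall t, d2 t = 0 <->
        val t.1 * rel_own s + val t.2 * rel_opp (opp s) = 0 /\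
        val t.2 * rel_own (opp s) + val t.1 * rel_opp s = 0].
Proof.
have is1 : inner s by case/arcP: si.
pose e : {linear P0 -> M} := li_lift ((1 : K) : M).
pose as1 := LeftIdeal (arrow_in_ev s);
  pose ao1 := LeftIdeal (opp_arrow_in_ev s).
have [d1 d1E] := linear_row (li_lift as1 : {linear left_ideal (idem_target s)
  -> P0})
  (li_lift ao1 : {linear left_ideal (idem_target (opp s)) -> P0}).
pose m11 := LeftIdeal (rel_own_in_target s);
  pose m12 := LeftIdeal (rel_opp_in_target s).
pose m21 := LeftIdeal (rel_opp_in_target' s);
  pose m22 := LeftIdeal (rel_own_in_target (opp s)).
have [d2 d2E] := linear_matrix
  (li_lift m11 : {linear left_ideal (idem_source s) -> _})
  (li_lift m21 : {linear left_ideal (idem_source (opp s)) -> _})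
  (li_lift m12 : {linear left_ideal (idem_source s) -> _})
  (li_lift m22 : {linear left_ideal (idem_source (opp s)) -> _}).
have d1V v : val (d1 v) = val v.1 * V 1 [:: s] + val v.2 * V 1 [:: opp s].
  by rewrite d1E.
have sourceM r (t : left_ideal (idem_source r)) A :
    val t * (idem_source r * A) = val t * A.
  by rewrite mulrA li_valM.
have d2V1 t : val (d2 t).1 = val t.1 * rel_own s + val t.2 * rel_opp (opp s).
  by rewrite d2E -(sourceM s t.1) -(sourceM (opp s) t.2).
have d2V2 t : val (d2 t).2 = val t.2 * rel_own (opp s) + val t.1 * rel_opp s.
  by rewrite d2E -(sourceM s t.1) -(sourceM (opp s) t.2) [RHS]addrC.
have eV (u : P0) f : val u = mk f -> e u = f (ptriv i) :> K.
  move=> uf; rewrite -[e u]/((repr (val (val u)) (ptriv i) : K) * 1) mulr1 uf.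
  by rewrite (repr_ptriv (potential_no_short_cycles wt val3)) /deg0 /degree
    big_nil.
exists e, d1, d2; split.
- move=> m.
  have m_in : mk (mono (m : K) [::] * vert K s) \in fixed_by (ev s).
    by rewrite unfold_in -mkM -mulrA vert_idem.
  exists (LeftIdeal m_in); rewrite (eV _ (mono (m : K) [::] * vert K s)) //.
  by rewrite mulvertE [pstart _]/= si /mono /= mulr1.
- move=> u; have [f uf] := mk_surj (val u); split=> [eu|[v vu]].
    have f0 : f (ptriv i) = 0 by rewrite -(eV _ _ uf).
    have [A [B AB]] := first_arrows si f0.
    have A_in : A * idem_target s \in fixed_by (idem_target s).
      by rewrite unfold_in -mulrA idem_target_idem.
    have B_in : B * idem_target (opp s) \in fixed_by (idem_target (opp s)).
      by rewrite unfold_in -mulrA idem_target_idem.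
    exists (LeftIdeal A_in, LeftIdeal B_in); apply: val_inj.
    by rewrite d1V /= -AB -uf li_valM.
  rewrite -vu; have [f1 e1] := mk_surj (val v.1);
    have [f2 e2] := mk_surj (val v.2).
  rewrite (eV _ (f1 * mono 1 [:: s] + f2 * mono 1 [:: opp s])); last first.
    by rewrite d1V e1 e2 mkD !mkM.
  by rewrite cpaDE !mulmonoE addr0.
- move=> v; split=> [d1v|[t <-]].
    have [f1 e1] := mk_surj (val v.1); have [f2 e2] := mk_surj (val v.2).
    have : mk (f1 * mono 1 [:: s] + f2 * mono 1 [:: opp s]) = 0.
      by rewrite mkD !mkM -e1 -e2 -d1V d1v.
    case/first_syzygy/(_ is1) => A [B [hA hB]].
    have A_in : A * idem_source s \in fixed_by (idem_source s).
      by rewrite unfold_in -mulrA idem_source_idem.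
    have B_in : B * idem_source (opp s) \in fixed_by (idem_source (opp s)).
      by rewrite unfold_in -mulrA idem_source_idem.
    exists (LeftIdeal A_in, LeftIdeal B_in).
    rewrite [LHS]surjective_pairing [RHS]surjective_pairing; congr pair; apply:
      val_inj.
      rewrite d2V1 /=; case us : (uncut s).
        rewrite -!mulrA idem_source_own // idem_source_rel_opp ?opp_opp // -hA
          // -e1.
        by rewrite -[RHS]li_valM; congr (_ * _); rewrite /idem_target us.
      (* Without an arrow [s] in Lambda this component lies in a zero module, and both matrix
         entries into it vanish. *)
      have id0 : idem_target s = 0 by rewrite /idem_target us.
      rewrite (li_val0 _ id0) -!mulrA -rel_own_target.
      have := eqP (rel_opp_in_target' s); rewrite id0 mulr0 => <-.
      by rewrite !mulr0 addr0.
    rewrite d2V2 /=; case us : (uncut (opp s)).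
      rewrite -!mulrA idem_source_own // idem_source_rel_opp // -hB // -e2.
      by rewrite -[RHS]li_valM; congr (_ * _); rewrite /idem_target us.
    have id0 : idem_target (opp s) = 0 by rewrite /idem_target us.
    rewrite (li_val0 _ id0) -!mulrA -rel_own_target.
    have := eqP (rel_opp_in_target s); rewrite id0 mulr0 => <-.
    by rewrite !mulr0 addr0.
  apply: val_inj; rewrite d1V d2V1 d2V2 !mulrDl -!mulrA.
  rewrite [X in _ + X]addrC addrACA -!mulrDr [X in _ * _ + _ * X]addrC.
  rewrite -(sourceM s t.1) -(sourceM (opp s) t.2).
  have := relation_syzygy (opp s); rewrite opp_opp => ->.
  by rewrite (relation_syzygy s) !mulr0 addr0.
- move=> t; rewrite -d2V1 -d2V2; split=> [->//|[t1 t2]].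
  by rewrite [LHS]surjective_pairing; congr pair; apply: val_inj.
Qed.

Lemma syzygy_radical (A B : Lam) : A * idem_source s = A ->
  B * idem_source (opp s) = B ->
  A * rel_own s + B * rel_opp (opp s) = 0 ->
  B * rel_own (opp s) + A * rel_opp s = 0 -> Rad 1 A /\ Rad 1 B.
Proof.
move=> eA eB r1 r2; have [f [g [-> -> sfg]]] := to_syzygy eA eB r1 r2.
have rad f' g' s' : syzygy s' f' g' -> Rad 1 (mk f').
  move=> sfg'; exists f' => // p; rewrite /order_ge ltnS leqn0 => /eqP p0.
  have -> : p = ptriv (pstart p) by apply: qpath_eq => //; apply: size0nil.
  exact: (syzygy_trivial _ sfg').
by split; [apply: rad sfg | apply: rad (syzygy_sym sfg)].
Qed.

Lemma projective_modules : [/\ projective P0, projective P1 & projective P2].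
Proof.
split; first exact/left_ideal_projective/ev_idem.
  apply: projective_prod; apply: left_ideal_projective; exact: idem_target_idem.
apply: projective_prod; apply: left_ideal_projective; exact: idem_source_idem.
Qed.

Lemma pdim_corner : pdim_ge M 3 <->
  (corner_I s \/ corner_II (cw (cw s))) \/
  (corner_I (opp s) \/ corner_II (cw (cw (opp s)))).
Proof.
have [e [d1 [d2 [e_surj exact0 exact1 ker]]]] := simple_resolution.
split=> [pd|corner m res].
  apply: contrapT => nc.
  have [nI nII] : ~ corner_I s /\ ~ corner_II (cw (cw s)).
    by split=> c; apply: nc; left; [left | right].
  have [nI' nII'] : ~ corner_I (opp s) /\ ~ corner_II (cw (cw (opp s))).
    by split=> c; apply: nc; right; [left | right].
  have := pd _ (resolution_length2 projective_modules e_surj exact0 exact1 _).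
  suff inj t : d2 t = 0 -> t = 0 by move=> /(_ inj).
  case/ker=> r1 r2.
  have [f [g [ef eg sfg]]] := to_syzygy (li_valM t.1) (li_valM t.2) r1 r2.
  have f0 := syzygy_zero sfg nI nII nI' nII'.
  have := syzygy_zero (syzygy_sym sfg) nI' nII'.
  rewrite opp_opp => /(_ nI nII) g0.
  by rewrite [t]surjective_pairing; congr pair; apply: val_inj; rewrite ?ef ?eg.
rewrite leqNgt; apply/negP => m3.
have [u [u_ker u_id]] := projection_on_kernel projective_modules e_surj exact0
  exact1 m3 res.
have radker t : d2 t = 0 -> Rad 1 (val t.1) /\ Rad 1 (val t.2).
  by case/ker => r1 r2; apply: syzygy_radical => //; apply: li_valM.
(* The argument of Nakayama's lemma: [t = u t] is the combination of [u g1] and [u g2] with the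
   components of [t] as coefficients. Both images lie in the kernel, hence in the radical, so each
   round gains one power. *)
have ker0 n t : d2 t = 0 -> Rad n (val t.1) /\ Rad n (val t.2).
  elim: n t => [|n IH] t t0; first by split; apply: radical_power0.
  have [r1 r2] := IH t t0.
  pose g1 : P2 := (li_gen (idem_source_idem s), 0).
  pose g2 : P2 := (0, li_gen (idem_source_idem (opp s))).
  have tE : t = val t.1 *: g1 + val t.2 *: g2.
    rewrite [LHS]surjective_pairing /g1 /g2; congr pair => /=.
      by rewrite scaler0 addr0 -li_genE.
    by rewrite scaler0 add0r -li_genE.
  have := u_id t t0; rewrite {1}tE linearD !linearZ => <- /=.
  have [a1 a2] := radker _ (u_ker g1); have [b1 b2] := radker _ (u_ker g2).
  by split; apply: radical_powerD; rewrite -addn1; apply: radical_powerM.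
have ker_eq0 t : d2 t = 0 -> val t.1 = 0 /\ val t.2 = 0.
  by move=> t0; split; apply: radical_power_eq0 => n; have [] := ker0 n t t0.
case: corner => /corner_kernel[A [B [A0 eA eB r1 r2]]].
  have A_in : A \in fixed_by (idem_source s) by rewrite unfold_in eA.
  have B_in : B \in fixed_by (idem_source (opp s)) by rewrite unfold_in eB.
  have [|/= A0'] := ker_eq0 (LeftIdeal A_in, LeftIdeal B_in); first exact/ker.
  by case: A0.
rewrite opp_opp in eB r1 r2.
have A_in : A \in fixed_by (idem_source (opp s)) by rewrite unfold_in eA.
have B_in : B \in fixed_by (idem_source s) by rewrite unfold_in eB.
have [|/= _ A0'] := ker_eq0 (LeftIdeal B_in, LeftIdeal A_in); last by case: A0.
by apply/ker; split.
Qed.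

End Resolution.
Theorem pdim_simple_module (i : vertex Q) :
  pdim_ge (simple_module (potential_no_short_cycles wt val3) d i) 3 <->
  configuration_I d i \/ configuration_II d i.
Proof.
have [s si] : exists s, s \in val i.
  by have /imsetP[s _ iE] := valP i; exists s; rewrite iE !inE eqxx.
rewrite (pdim_corner si) (configuration_I_corner si) (configuration_II_corner
  si).
tauto.
Qed.

End Syzygies.

Theorem proposition7p3 (R : realType) (tau : triangulation)
  (boundary : has_boundary tau) (val3 : valency_ge3 tau)
  (x : {set side tau} -> complex R)
  (x_neq0 : forall p, p \in punctures tau -> x p != 0%R)
  (d : arrow (tri_quiver tau) -> bool)
  (d_cut : admissible_cut (potential x) d)
  (i : vertex (tri_quiver tau)) :
  pdim_ge (simple_module (potential_no_short_cycles x val3) d i) 3 <->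
  configuration_I d i \/ configuration_II d i.
Proof. exact: pdim_simple_module. Qed.
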